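(* Let $V$ be a graded vector space regarded as a formal graded manifold, and let $\Gamma=\sum_{n\ge1}\Gamma_n\in\wedge^{\bullet\ge1}\mathcal T_V$ be a polyvector field with associated brackets $L_n:\mathcal O_V^{\otimes n}\to\mathcal O_V$, $n\ge1$. The brackets $L_n$ are graded skew commutative and have the graded Leibniz property in each argument, i.e. for all $n\ge1$, all $1\le j\le n$ and all homogeneous $f_i,g,h\in\mathcal O_V$, $$L_n(f_1,\dots,f_{j-1},gh,f_{j+1},\dots,f_n)=(-1)^{|g|(|L_n|+|f_1|+\dots+|f_{j-1}|)}\,g\,L_n(f_1,\dots,h,\dots,f_n)+(-1)^{|h|(|f_{j+1}|+\dots+|f_n|)}L_n(f_1,\dots,g,\dots,f_n)\,h,$$ where $h$, respectively $g$, stands in the $j$-th argument on the right (for inhomogeneous $\Gamma_n$ the identity is understood for each homogeneous component of $L_n$). Moreover, the family $\{L_n\}_{n\ge1}$ gives $\mathcal O_V$ the structure of an $L_\infty$ algebra if and only if $\Gamma$ is an extended Poisson structure, i.e. $|\Gamma|=2$ and $[\Gamma,\Gamma]=0$ for the odd Schouten bracket.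
   Context: $\mathbb K$ is a field of characteristic zero; Koszul sign rules apply. Let $\{e_a\}$ be a homogeneous basis of $V$ and $\{t^a\}$ the dual basis, $|t^a|=-|e_a|$. The formal graded manifold $V$ has structure sheaf $\mathcal O_V=\widehat{\odot^\bullet V^*}\cong\mathbb K[[t^a]]$. $\mathcal T_V$ is the module of derivations of $\mathcal O_V$, generated by $\partial_a=\partial/\partial t^a$; $\wedge^\bullet\mathcal T_V:=\odot^\bullet_{\mathcal O_V}(\mathcal T_V[-1])\cong\mathbb K[[t,\psi]]$ (where $W[i]_j=W_{i+j}$), with $\psi_a$ corresponding to $\partial_a$ and $|\psi_a|=1-|t^a|$; $\wedge^i\mathcal T_V$ is the part with $i$ factors $\psi$, and $|\Gamma|$ is the total degree in the $t^a,\psi_a$. The odd Schouten bracket is $[A,B]=A\bullet B+(-1)^{|A||B|+|A|+|B|}B\bullet A$ with $A\bullet B=\sum_a\frac{\partial A}{\partial\psi_a}\frac{\partial B}{\partial t^a}$ ($\psi$-derivative from the right, $t$-derivative from the left). An extended Poisson structure on $V$ is an element $\Gamma\in\wedge^{\bullet\ge1}\mathcal T_V$ of degree two with $[\Gamma,\Gamma]=0$. Brackets: write the weight-$n$ component as $\Gamma_n=\frac1{n!}\sum\Gamma^{a_1\dots a_n}(t)\psi_{a_1}\cdots\psi_{a_n}$, with coefficients $\Gamma^{a_1\dots a_n}(t)\in\mathcal O_V$ having the graded symmetry of the monomials $\psi_{a_1}\cdots\psi_{a_n}$. For homogeneous $f_1,\dots,f_n\in\mathcal O_V$, $$L_n(f_1,\dots,f_n)=\sum(-1)^{\epsilon}\,\Gamma^{a_1\dots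 a_n}(t)(\partial_{a_1}f_1)\cdots(\partial_{a_n}f_n),\qquad \epsilon=\sum_{i=2}^n|t^{a_i}|\,(|f_1|+\dots+|f_{i-1}|+i-1).$$ $L_\infty$ algebra: a graded vector space $W$ with graded skew symmetric maps $l_n:W^{\otimes n}\to W$ of degree $2-n$, $n\ge1$, such that for all $n\ge1$ and homogeneous $v_1,\dots,v_n$ $$\sum_{r+s=n+1}\ \sum_{\sigma}\epsilon(\sigma)\,\mathrm{sgn}(\sigma)(-1)^{r(s-1)}\,l_r\big(l_s(v_{\sigma(1)},\dots,v_{\sigma(s)}),v_{\sigma(s+1)},\dots,v_{\sigma(n)}\big)=0,$$ where $\sigma$ runs over $(s,n-s)$-unshuffles and $\epsilon(\sigma)$ is the Koszul sign of permuting $v_1,\dots,v_n$ by $\sigma$.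
   Formalization: The L∞ relations are taken with sign (-1)^r instead of (-1)^{r(s-1)}, since with the latter the equivalence fails (relative sign of the [Γ_2,Γ_2] and [Γ_1,Γ_3] terms); V is finite dimensional, as the dual basis requires. *)

(* Defs.v *)
(* Mathematical Components; the lmodType structure on functions comes from
   mathcomp-classical. *)
From HB Require Import structures.
From mathcomp Require Import all_boot all_order all_algebra all_fingroup.
From mathcomp Require Import boolp functions.
From mathcomp Require Import zify ring.

Set Implicit Arguments.
Unset Strict Implicit.
Unset Printing Implicit Defensive.

Import GRing.Theory.
Local Open Scope ring_scope.

(** * Graded-commutative formal power series *)

(* Monomials x_0^{M 0} ... x_{m-1}^{M (m-1)}, factors in increasing order, in
   graded-commutative variables of degrees [d]; variables of odd degree square
   to zero. *)
Record gmon (m : nat) (d : 'I_m -> int) := GMon {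
  mexp :> {ffun 'I_m -> nat};
  _ : [forall i, odd `|d i|%N ==> (mexp i <= 1)%N]
}.

HB.instance Definition _ m d := [isSub for @mexp m d].
HB.instance Definition _ m d := [Countable of @gmon m d by <:].

(* The algebra K[[x_0, ..., x_{m-1}]]. *)
Definition gseries (K : fieldType) (m : nat) (d : 'I_m -> int) :=
  gmon d -> K^o.

HB.instance Definition _ (K : fieldType) m (d : 'I_m -> int) :=
  GRing.Lmodule.copy (gseries K d) (gmon d -> K^o).

Section GradedSeries.
Variables (K : fieldType) (m : nat) (d : 'I_m -> int).
Implicit Types (M : gmon d) (f g : gseries K d).

Definition gdeg M : int := \sum_i (M i)%:Z * d i.

(* The coefficient at an exponent; zero if the monomial vanishes. *)
Definition gcoef f (N : {ffun 'I_m -> nat}) : K :=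
  if insub N is Some M then f M else 0.

(* x^P x^Q = (-1)^(reorder_exp P Q) x^(P+Q): for j < i, the power of x_j in
   x^Q moves to the left past the power of x_i in x^P. *)
Definition reorder_exp (P Q : {ffun 'I_m -> nat}) : int :=
  \sum_(i < m) \sum_(j < m | (j < i)%N) (P i)%:Z * d i * ((Q j)%:Z * d j).

Definition gmul f g : gseries K d := fun M =>
  \sum_(N : {dffun forall i : 'I_m, 'I_(M i).+1})
    let P := [ffun i => nat_of_ord (N i)] in
    let Q := [ffun i => (M i - N i)%N] in
    (-1) ^ reorder_exp P Q * gcoef f P * gcoef g Q.

Definition gone : gseries K d := fun M => [forall i, M i == 0%N]%:R.

Definition gprod (fs : seq (gseries K d)) : gseries K d :=
  \big[gmul/gone]_(f <- fs) f.

Definition gvar (i : 'I_m) : gseries K d := fun M =>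
  [forall j, M j == (j == i)]%:R.

Definition mincr (M : {ffun 'I_m -> nat}) (i : 'I_m) : {ffun 'I_m -> nat} :=
  [ffun j => (M j + (j == i))%N].

(* The derivatives acting from the left, resp. from the right: the derivation
   (of the parity of x_i) passes the variables preceding, resp. following,
   x_i. *)
Definition gderl (i : 'I_m) f : gseries K d := fun M =>
  (-1) ^ (d i * \sum_(j < m | (j < i)%N) (M j)%:Z * d j)
    * (M i).+1%:R * gcoef f (mincr M i).

Definition gderr (i : 'I_m) f : gseries K d := fun M =>
  (-1) ^ (d i * \sum_(j < m | (i < j)%N) (M j)%:Z * d j)
    * (M i).+1%:R * gcoef f (mincr M i).

Definition ghomog (k : int) f : Prop := forall M, f M != 0 -> gdeg M = k.

Definition ghcomp (k : int) f : gseries K d := fun M =>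
  if gdeg M == k then f M else 0.

End GradedSeries.

(** * L-infinity algebras

   A graded vector space is given by its homogeneous components
   [hom k], subspaces of an ambient space [W] with direct sum.  A homogeneous
   vector is a pair (degree, vector).  A family of graded maps
   l_n : W^{(x) n} -> W is a single function [l] on lists of homogeneous
   vectors: l [:: (k_1, v_1); ...; (k_n, v_n)] is the value at
   v_1 (x) ... (x) v_n of the restriction of l_n to
   W_{k_1} (x) ... (x) W_{k_n}. *)

Section LInfinity.
Variables (K : fieldType) (W : lmodType K) (hom : int -> W -> Prop).
Implicit Types (v : seq (int * W)) (l : seq (int * W) -> W).

Definition graded_space : Prop :=
  [/\ forall k, hom k 0,
      forall k (a : K) u w, hom k u -> hom k w -> hom k (a *: u + w)
    & forall (s : seq int) (w : int -> W), uniq s -> (forall k, hom k (w k)) ->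
        \sum_(k <- s) w k = 0 -> forall k, k \in s -> w k = 0].

Definition homog_args v : Prop := forall x, x \in v -> hom x.1 x.2.

Definition totdeg v : int := \sum_(x <- v) x.1.

(* (-1)^(koszul_exp k sigma) is the sign epsilon(sigma) in
   v_{sigma 1} ... v_{sigma n} = epsilon(sigma) v_1 ... v_n, |v_i| = k i. *)
Definition koszul_exp n (k : 'I_n -> int) (sigma : 'S_n) : int :=
  \sum_(i < n) \sum_(j < n | (i < j)%N && (sigma j < sigma i)%N)
     k (sigma i) * k (sigma j).

Definition permute T n (v : n.-tuple T) (sigma : 'S_n) : n.-tuple T :=
  [tuple tnth v (sigma i) | i < n].

Definition multilinear l : Prop :=
  forall v v' k (a : K) u w,
    homog_args v -> homog_args v' -> hom k u -> hom k w ->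
    l (v ++ (k, a *: u + w) :: v') =
      a *: l (v ++ (k, u) :: v') + l (v ++ (k, w) :: v').

Definition graded_skew l : Prop :=
  forall n (v : n.-tuple (int * W)) (sigma : 'S_n),
    (0 < n)%N -> homog_args v ->
    l (permute v sigma) =
      ((-1) ^ koszul_exp (fun i => (tnth v i).1) sigma * (-1) ^+ sigma) *: l v.

(* (s, n-s)-unshuffles *)
Definition unshuffle n (s : nat) (sigma : 'S_n) : bool :=
  [forall i : 'I_n, forall j : 'I_n,
     (i < j)%N && ((j < s)%N || (s <= i)%N) ==> (sigma i < sigma j)%N].

(* The left-hand side of the n-th generalized Jacobi identity, with
   (-1)^(eta r s) the sign of the term l_r (l_s (_), _). *)
Definition jacobiator (eta : nat -> nat -> nat) l n
    (v : n.-tuple (int * W)) : W :=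
  \sum_(s < n.+1 | (0 < s)%N) \sum_(sigma : 'S_n | unshuffle s sigma)
    let r := (n.+1 - s)%N in
    let w := permute v sigma in
    ((-1) ^ koszul_exp (fun i => (tnth v i).1) sigma * (-1) ^+ sigma
       * (-1) ^+ eta r s) *:
    l ((totdeg (take s w) + 2 - s%:Z, l (take s w)) :: drop s w).

Record linfty_with (eta : nat -> nat -> nat) l : Prop := {
  linfty_graded : graded_space;
  linfty_multilinear : multilinear l;
  linfty_degree : forall v, (0 < size v)%N -> homog_args v ->
    hom (totdeg v + 2 - (size v)%:Z) (l v);
  linfty_skew : graded_skew l;
  linfty_jacobi : forall n (v : n.-tuple (int * W)), (0 < n)%N ->
    homog_args v -> jacobiator eta l v = 0
}.

(* The Jacobi identities occur with the signs (-1)^r and with the signs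
   (-1)^(r(s-1)); l_n |-> (-1)^(n(n-1)/2) l_n exchanges the two conventions,
   see [linfty_resign].  The choice matters: the unrescaled brackets of a
   polyvector field, defined below, match the Schouten bracket in the
   convention (-1)^r only.  For Gamma of degree 2, the convention
   (-1)^(r(s-1)) would turn the weight-3 part
   2 [Gamma_1, Gamma_3] + [Gamma_2, Gamma_2] = 0 of [Gamma, Gamma] = 0 into
   2 [Gamma_1, Gamma_3] - [Gamma_2, Gamma_2] = 0. *)
Definition linfty l : Prop := linfty_with (fun r _ => r) l.

Definition resign l : seq (int * W) -> W := fun v =>
  (-1) ^+ 'C(size v, 2) *: l v.

Lemma resignK l : resign (resign l) = l.
Proof.
by apply: funext => v; rewrite /resign scalerA -exprD -signr_odd oddD addbb scale1r.
Qed.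

Lemma multilinear_resign l : multilinear l -> multilinear (resign l).
Proof.
move=> lin v v' k a u w hv hv' hu hw; rewrite /resign lin // !size_cat /=.
by rewrite scalerDr !scalerA mulrC.
Qed.

Lemma degree_resign l : graded_space ->
  (forall v, (0 < size v)%N -> homog_args v ->
    hom (totdeg v + 2 - (size v)%:Z) (l v)) ->
  forall v, (0 < size v)%N -> homog_args v ->
    hom (totdeg v + 2 - (size v)%:Z) (resign l v).
Proof.
move=> [hom0 homZD _] ldeg v v_gt0 hv.
by rewrite /resign -[_ *: _]addr0; apply: homZD => //; apply: ldeg.
Qed.

Lemma skew_resign l : graded_skew l -> graded_skew (resign l).
Proof.
move=> skew n v sigma n_gt0 hv.
by rewrite /resign skew // !size_tuple !scalerA mulrC.
Qed.

Lemma jacobiator_resign eta l n (v : n.-tuple (int * W)) : graded_space ->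
  multilinear l ->
  (forall v, (0 < size v)%N -> homog_args v ->
    hom (totdeg v + 2 - (size v)%:Z) (l v)) ->
  homog_args v ->
  jacobiator (fun r s => eta r s + r * s)%N (resign l) v =
  (-1) ^+ 'C(n.+1, 2) *: jacobiator eta l v.
Proof.
move=> [hom0 homZD _] lin ldeg hv.
rewrite /jacobiator scaler_sumr; apply: eq_bigr => s s_gt0.
rewrite scaler_sumr; apply: eq_bigr => sigma _ /=.
set w := permute v sigma.
have hw : homog_args w.
  by move=> x /mapP[i _ ->]; apply: hv; exact: mem_tnth.
have s_le : (s <= n)%N by rewrite -ltnS.
have szt : size (take s w) = s by rewrite size_take size_tuple; case: ltngtP s_le.
have szd : size (drop s w) = (n - s)%N by rewrite size_drop size_tuple.
have ht : homog_args (take s w) by move=> x /mem_take; exact: hw.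
have hd : homog_args (drop s w) by move=> x /mem_drop; exact: hw.
have hl : hom (totdeg (take s w) + 2 - s%:Z) (l (take s w)).
  by rewrite -[X in _ - X%:Z]szt; apply: ldeg => //; rewrite szt.
rewrite /resign /= szt szd -subSn // -[_ *: l (take s w)]addr0.
have hnil : homog_args [::] by move=> x; rewrite in_nil.
have := lin [::] (drop s w) _ ((-1) ^+ 'C(s, 2)) _ 0 hnil hd hl (hom0 _).
rewrite !cat0s => ->.
have -> : l ((totdeg (take s w) + 2 - s%:Z, 0) :: drop s w) = 0.
  have := lin [::] (drop s w) (totdeg (take s w) + 2 - s%:Z) 1 0 0 hnil hd
    (hom0 _) (hom0 _).
  rewrite !cat0s scaler0 addr0 scale1r => /eqP.
  by rewrite -subr_eq0 opprD addNKr oppr_eq0 => /eqP.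
rewrite addr0 !scalerA; congr (_ *: _).
have -> : 'C(n.+1, 2) = ('C(n.+1 - s, 2) + 'C(s, 2) + (n.+1 - s) * s)%N.
  have {1}-> : n.+1 = (n.+1 - s + s)%N by rewrite subnK // ltnW.
  move: (n.+1 - s)%N => r.
  elim: r => [|r IHr]; first by rewrite bin0n mul0n !add0n addn0.
  by rewrite addSn binS IHr bin1 binS bin1 mulSn; lia.
rewrite !exprD.
set A := (-1) ^+ 'C(_ - _, 2); set B := (-1) ^+ 'C(s, 2); set C := (-1) ^+ (_ * _).
set E := (-1) ^+ eta _ _; set D := _ ^ _; set F := _ ^+ sigma.
ring.
Qed.

Lemma jacobiator_mod eta eta' l n (v : n.-tuple (int * W)) :
  (forall r s, (r + s = n.+1)%N -> (0 < s)%N -> odd (eta r s) = odd (eta' r s)) ->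
  jacobiator eta l v = jacobiator eta' l v.
Proof.
move=> eqeta; apply: eq_bigr => s s_gt0; apply: eq_bigr => sigma _ /=.
rewrite -[(-1) ^+ eta _ _]signr_odd (eqeta (n.+1 - s)%N s) ?signr_odd //.
by rewrite subnK // ltnW.
Qed.

Lemma linfty_resign l :
  linfty l <-> linfty_with (fun r s => r * s.-1)%N (resign l).
Proof.
split=> -[gr lin deg skew jac].
  split=> //; [exact: multilinear_resign|exact: degree_resign|exact: skew_resign|].
  move=> n v n_gt0 hv.
  rewrite (@jacobiator_mod _ (fun r s => r + r * s)%N); last first.
    by move=> r [//|s] _ _ /=; rewrite mulnS addnA addnn oddD odd_double.
  by rewrite jacobiator_resign // jac // scaler0.
rewrite -[l]resignK.
split=> //; [exact: multilinear_resign|exact: degree_resign|exact: skew_resign|].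
move=> n v n_gt0 hv.
rewrite (@jacobiator_mod _ (fun r s => r * s.-1 + r * s)%N); last first.
  by move=> r [//|s] _ _ /=; rewrite mulnS addnCA addnn oddD odd_double addbF.
by rewrite jacobiator_resign // jac // scaler0.
Qed.

End LInfinity.

(** * Formal graded manifolds, polyvector fields and their brackets

   The graded vector space V has a homogeneous basis e_0, ..., e_{m-1} with
   |e_a| = dV a. *)

Section FormalManifold.
Variables (K : fieldType) (m : nat) (dV : 'I_m -> int).

Definition tdeg (a : 'I_m) : int := - dV a.

Local Notation OV := (gseries K tdeg).

(* The variables of K[[t, psi]] are t^0, ..., t^{m-1}, psi_0, ..., psi_{m-1}. *)
Definition pvdeg (i : 'I_(m + m)) : int :=
  match fintype.split i with inl a => tdeg a | inr a => 1 - tdeg a end.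

Local Notation PV := (gseries K pvdeg).

Definition tvar (a : 'I_m) : 'I_(m + m) := lshift m a.
Definition psivar (a : 'I_m) : 'I_(m + m) := rshift m a.

Definition pvweight (M : gmon pvdeg) : nat := (\sum_a M (psivar a))%N.

Definition pv_wcomp (n : nat) (Gamma : PV) : PV := fun M =>
  if pvweight M == n then Gamma M else 0.

Definition pv_positive (Gamma : PV) : Prop := pv_wcomp 0 Gamma = 0.

(* The inclusion K[[t]] -> K[[t, psi]]. *)
Definition OV_PV (f : OV) : PV := fun M =>
  if pvweight M == 0%N then gcoef f [ffun a => M (tvar a)] else 0.

Definition schouten_bullet (A B : PV) : PV :=
  \sum_(a < m) gmul (gderr (psivar a) A) (gderl (tvar a) B).

(* The odd Schouten bracket of A of degree [p] and B of degree [q]. *)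
Definition schouten (p q : int) (A B : PV) : PV :=
  schouten_bullet A B + (-1) ^ (p * q + p + q) *: schouten_bullet B A.

Definition extended_poisson (Gamma : PV) : Prop :=
  [/\ pv_positive Gamma, ghomog 2 Gamma & schouten 2 2 Gamma Gamma = 0].

(* [c [:: a_1; ...; a_n]] is the coefficient Gamma^{a_1 ... a_n}(t); in
   characteristic zero the two conditions determine c on nonempty lists. *)
Definition pv_coefficients (Gamma : PV) (c : seq 'I_m -> OV) : Prop :=
  forall n, (0 < n)%N ->
    (forall (a : n.-tuple 'I_m) (sigma : 'S_n),
       c (permute a sigma) =
         (-1) ^ koszul_exp (fun i => 1 - tdeg (tnth a i)) sigma *: c a) /\
    pv_wcomp n Gamma =
      (n`!%:R)^-1 *: \sum_(a : n.-tuple 'I_m)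
        gmul (OV_PV (c a))
             (gprod [seq gvar K (psivar b) | b <- a]).

(* L_n (f_1, ..., f_n), for the list of the pairs (|f_i|, f_i); indices are
   counted from 0, so that i is the number of arguments before f_i. *)
Definition bracket (c : seq 'I_m -> OV) (fs : seq (int * OV)) : OV :=
  let n := size fs in
  let f := in_tuple fs in
  \sum_(a : n.-tuple 'I_m)
    (-1) ^ (\sum_(i < n) tdeg (tnth a i)
                * (\sum_(j < n | (j < i)%N) (tnth f j).1 + i%:Z)) *:
    gmul (c a)
      (gprod [seq gderl (tnth a i) (tnth f i).2 | i <- enum 'I_n]).

(* The component of degree e of L_n. *)
Definition bracket_comp (c : seq 'I_m -> OV) (e : int)
    (fs : seq (int * OV)) : OV :=
  ghcomp (totdeg fs + e) (bracket c fs).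

Definition graded_leibniz (c : seq 'I_m -> OV) : Prop :=
  forall (e p q : int) (fs fs' : seq (int * OV)) (g h : OV),
    homog_args (@ghomog K m tdeg) fs -> homog_args (@ghomog K m tdeg) fs' ->
    ghomog p g -> ghomog q h ->
    bracket_comp c e (fs ++ (p + q, gmul g h) :: fs') =
      (-1) ^ (p * (e + totdeg fs)) *:
         gmul g (bracket_comp c e (fs ++ (q, h) :: fs'))
      + (-1) ^ (q * totdeg fs') *:
         gmul (bracket_comp c e (fs ++ (p, g) :: fs')) h.

End FormalManifold.

Notation OV K dV := (gseries K (tdeg dV)).
Notation PV K dV := (gseries K (pvdeg dV)).

(* Main.v *)
Require Import Defs.
From HB Require Import structures.
From mathcomp Require Import all_boot all_order all_algebra all_fingroup ssrAC.
From mathcomp Require Import boolp functions.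
From mathcomp Require Import zify ring.

Set Implicit Arguments.
Unset Strict Implicit.
Unset Printing Implicit Defensive.

Import GRing.Theory.
Local Open Scope ring_scope.

(** Let [contract f A] = sum_a (dA/dpsi_a)(df/dt^a) be the contraction of a
   polyvector field with a function.  Up to the decalage sign
   (-1)^(sum_i (n - i)(|f_i| - 1)), the bracket L_n(f_1, ..., f_n) is the
   derived bracket obtained by contracting Gamma successively with f_1, ..., f_n
   and setting psi = 0.  Contractions with f and g commute up to the Koszul sign
   for the shifted degrees |f| - 1 and |g| - 1, and contraction with gh expands
   by the product rule; this gives the skew symmetry and the Leibniz property.

   Contraction with f is also a derivation of the Schouten bracket: the terms
   containing second derivatives of f coming from A . B cancel those coming from
   B . A.  Contracting [Gamma, Gamma] with f_1, ..., f_n therefore distributes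
   the f_i over the two factors, and at psi = 0 it yields twice the sum over all
   unshuffles of the nested brackets L(L(f_S), f_(S^c)), that is, up to a sign,
   twice the n-th Jacobiator.  In characteristic zero an element of K[[t, psi]]
   is determined by its contractions with the coordinate functions t^a at
   psi = 0, whence the equivalence. *)

(** A function f does not involve psi, so f . A = 0 and [contract f A] is the Schouten bracket
    [A, f]. Its derivation property is the graded Jacobi identity with one function among the three
    arguments. The contraction has degree |f| - 1, so the derived brackets are symmetric in shifted
    degrees, and the decalage sign makes them skew of degree 2 - n. The field is not assumed
    homogeneous. Skew symmetry and the Leibniz rule hold for any degrees, and |Gamma| = 2 has to be
    recovered from the degrees of the brackets. Reconstruction from coordinates is therefore stated
    as a criterion for homogeneity, and vanishing is deduced as homogeneity in two different
    degrees. Characteristic zero enters through the factorials in the coefficients, the integer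
    factors of derivatives, and the factor two. *)

(** * Parities of integers and signs *)

Definition oddz (e : int) : bool := odd `|e|%N.

Lemma oddzD a b : oddz (a + b) = oddz a (+) oddz b.
Proof. rewrite /oddz; lia. Qed.

Lemma oddzN a : oddz (- a) = oddz a.
Proof. rewrite /oddz; lia. Qed.

Lemma oddzM a b : oddz (a * b) = oddz a && oddz b.
Proof. by rewrite /oddz abszM oddM. Qed.

Lemma oddz_nat (n : nat) : oddz n%:Z = odd n.
Proof. by []. Qed.

Lemma signz_odd (K : fieldType) (e : int) : (-1) ^ e = (-1) ^+ oddz e :> K.
Proof.
case: e => n; rewrite /oddz /=; first by rewrite signr_odd.
by rewrite NegzE -exprnN -exprVn invrN1 -[in LHS]signr_odd.
Qed.

Definition oddzE := (oddzD, oddzN, oddzM, oddz_nat).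

Lemma oddz1 : oddz 1 = true. Proof. by []. Qed.
Lemma oddz2 : oddz 2 = false. Proof. by []. Qed.
Lemma oddz0 : oddz 0 = false. Proof. by []. Qed.

(* Equality of two signs: a truth table on the parities of the atoms of the
   exponents. *)
Ltac sign_eq :=
  rewrite ?signz_odd; congr (_ ^+ (nat_of_bool _));
  rewrite ?oddzE ?oddz1 ?oddz2 ?oddz0 ?oddD /=;
  repeat match goal with |- context [oddz ?x] => case: (oddz x) end;
  repeat match goal with |- context [odd ?x] => case: (odd x) end; by [].

Lemma signzD (K : fieldType) (a b : int) :
  (-1) ^ (a + b) = (-1) ^ a * (-1) ^ b :> K.
Proof. by rewrite !signz_odd oddzD signr_addb. Qed.

(** * Exponents and the boxes below them *)

Section Exponents.
Variable m : nat.
Local Notation expo := {ffun 'I_m -> nat}.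
Implicit Types (P Q N S : expo).

Definition eadd P Q : expo := [ffun i => (P i + Q i)%N].
Definition esub P Q : expo := [ffun i => (P i - Q i)%N].
Definition ele P Q := [forall i, (P i <= Q i)%N].

(** A list of raw exponents instead of the dependent functions over which [gmul] sums: boxes with
    different bounds then live in one type and can be reindexed into one another. *)
Definition ebox N : seq expo :=
  [seq [ffun i => nat_of_ord (x i)]
     | x : {dffun forall i : 'I_m, 'I_(N i).+1}
         <- enum {: {dffun forall i : 'I_m, 'I_(N i).+1}}].

Lemma eleP P Q : reflect (forall i, (P i <= Q i)%N) (ele P Q).
Proof. exact: forallP. Qed.

Lemma mem_ebox N P : (P \in ebox N) = ele P N.
Proof.
apply/mapP/eleP => [[x _ ->] i|le_PN]; first by rewrite ffunE -ltnS.
exists [ffun i => Ordinal (le_PN i : (P i < (N i).+1)%N)].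
  by rewrite mem_enum.
by apply/ffunP => i; rewrite !ffunE.
Qed.

Lemma ebox_uniq N : uniq (ebox N).
Proof.
rewrite map_inj_uniq ?enum_uniq // => x y /ffunP eq_xy.
by apply/ffunP => i; apply: val_inj; have := eq_xy i; rewrite !ffunE.
Qed.

Lemma esubK P N : ele P N -> eadd P (esub N P) = N.
Proof. by move/eleP => h; apply/ffunP => i; rewrite !ffunE subnKC. Qed.

Lemma eaddK P Q : esub (eadd P Q) P = Q.
Proof. by apply/ffunP => i; rewrite !ffunE addKn. Qed.

Lemma eaddC : commutative eadd.
Proof. by move=> P Q; apply/ffunP => i; rewrite !ffunE addnC. Qed.

Lemma eaddA : associative eadd.
Proof. by move=> P Q R; apply/ffunP => i; rewrite !ffunE addnA. Qed.

Lemma ele_addr P Q : ele P (eadd P Q).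
Proof. by apply/eleP => i; rewrite ffunE leq_addr. Qed.

Lemma ele_sub N P : ele (esub N P) N.
Proof. by apply/eleP => i; rewrite ffunE leq_subr. Qed.

Lemma esubKK P N : ele P N -> esub N (esub N P) = P.
Proof. by move/eleP => h; apply/ffunP => i; rewrite !ffunE subKn. Qed.

Lemma ele_trans Q P N : ele P Q -> ele Q N -> ele P N.
Proof.
by move=> /eleP h /eleP h'; apply/eleP => i; apply: leq_trans (h' i).
Qed.

Section Big.
Variables (V : nmodType).

Lemma big_ebox_shift N P (F : expo -> V) : ele P N ->
  \sum_(S <- ebox N | ele P S) F S = \sum_(Q <- ebox (esub N P)) F (eadd P Q).
Proof.
move=> le_PN; rewrite -big_filter -(big_map (eadd P) xpredT F).
apply: perm_big; apply: uniq_perm; first exact/filter_uniq/ebox_uniq.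
  by rewrite map_inj_uniq ?ebox_uniq // => Q Q' /(congr1 (esub^~ P));
    rewrite !eaddK.
move=> S; rewrite mem_filter mem_ebox; apply/andP/mapP => [[le_PS le_SN]|[Q]].
  exists (esub S P); last by rewrite esubK.
  rewrite mem_ebox; apply/eleP => i; rewrite !ffunE.
  by have := eleP _ _ le_SN i; lia.
rewrite mem_ebox => le_Q ->; split; first exact: ele_addr.
apply/eleP => i; have := eleP _ _ le_Q i; have := eleP _ _ le_PN i.
by rewrite !ffunE; lia.
Qed.

Lemma big_ebox_rev N (F : expo -> V) :
  \sum_(P <- ebox N) F P = \sum_(P <- ebox N) F (esub N P).
Proof.
rewrite -(big_map (esub N) xpredT F); apply: perm_big; apply: uniq_perm.
- exact: ebox_uniq.
- rewrite map_inj_in_uniq ?ebox_uniq // => P Q; rewrite !mem_ebox => hP hQ.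
  by move=> /(congr1 (esub N)); rewrite !esubKK.
move=> S; rewrite mem_ebox; apply/idP/mapP => [h|[Q hQ ->]];
  last exact: ele_sub.
by exists (esub N S); rewrite ?mem_ebox ?ele_sub ?esubKK.
Qed.

Lemma eq_big_ebox N (F G : expo -> V) :
  (forall P, ele P N -> F P = G P) ->
  \sum_(P <- ebox N) F P = \sum_(P <- ebox N) G P.
Proof. by move=> h; apply: eq_big_seq => P; rewrite mem_ebox => /h. Qed.

End Big.
End Exponents.

(** * The algebra of graded-commutative power series *)

Section SeriesRing.
Variables (K : fieldType) (m : nat) (d : 'I_m -> int).
Local Notation expo := {ffun 'I_m -> nat}.
Local Notation G := (gseries K d).
Implicit Types (f g h : G) (P Q N S : expo) (M : gmon d).

(** The condition carried by [gmon], on raw exponents: identities of series are checked there, with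
    [gcoef] extending the coefficients by zero. *)
Definition evalid N := [forall i, odd `|d i|%N ==> (N i <= 1)%N].

Definition expdeg N : int := \sum_i (N i)%:Z * d i.

Local Notation re := (reorder_exp d).

Lemma evalidP N :
  reflect (forall i, oddz (d i) -> (N i <= 1)%N) (evalid N).
Proof.
by apply: (iffP forallP) => h i; [exact: (implyP (h i)) | exact/implyP/h].
Qed.

Lemma evalid_le P N : ele P N -> evalid N -> evalid P.
Proof.
move=> /eleP le_PN /evalidP vN; apply/evalidP => i /vN.
exact: leq_trans.
Qed.

Lemma gcoef_val f M : gcoef f M = f M.
Proof. by rewrite /gcoef valK. Qed.

Lemma gcoef_invalid f N : ~~ evalid N -> gcoef f N = 0.
Proof. by move=> h; rewrite /gcoef insubN. Qed.

Lemma gseriesP f g : (forall N, evalid N -> gcoef f N = gcoef g N) -> f = g.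
Proof.
move=> h; apply: funext => M; rewrite -!gcoef_val; apply: h; exact: (valP M).
Qed.

Lemma gcoef_fun (F : expo -> K) N :
  gcoef ((fun M => F M) : G) N = if evalid N then F N else 0.
Proof. by rewrite /gcoef /evalid; case: insubP => [M -> <-|/negbTE ->]. Qed.

Lemma gcoefD f g N : gcoef (f + g) N = gcoef f N + gcoef g N.
Proof. by rewrite /gcoef; case: insubP => [M _ _|_] //; rewrite addr0. Qed.

Lemma gcoefZ a f N : gcoef (a *: f) N = a * gcoef f N.
Proof. by rewrite /gcoef; case: insubP => [M _ _|_] //; rewrite mulr0. Qed.

Lemma gcoef0 N : gcoef (0 : G) N = 0.
Proof. by rewrite /gcoef; case: insubP. Qed.

Lemma reorderD P Q N : re (eadd P Q) N = re P N + re Q N.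
Proof.
rewrite /reorder_exp -big_split; apply: eq_bigr => i _ /=.
by rewrite -big_split; apply: eq_bigr => j _ /=; rewrite ffunE PoszD; ring.
Qed.

Lemma reorderDr P Q N : re N (eadd P Q) = re N P + re N Q.
Proof.
rewrite /reorder_exp -big_split; apply: eq_bigr => i _ /=.
by rewrite -big_split; apply: eq_bigr => j _ /=; rewrite ffunE PoszD; ring.
Qed.

Lemma edegD P Q : expdeg (eadd P Q) = expdeg P + expdeg Q.
Proof.
by rewrite /expdeg -big_split; apply: eq_bigr => i _ /=; rewrite ffunE PoszD;
  ring.
Qed.

Lemma gcoefM f g N : evalid N -> gcoef (gmul f g) N =
  \sum_(P <- ebox N) (-1) ^ re P (esub N P) * gcoef f P * gcoef g (esub N P).
Proof.
move=> vN; rewrite {1}/gcoef insubT /gmul [RHS]big_map [RHS]big_enum /=.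
apply: eq_bigr => x _; set P := [ffun i => nat_of_ord (x i)].
rewrite (_ : [ffun i => (_ - _)%N] = esub N P) //.
by apply/ffunP => i; rewrite !ffunE.
Qed.

(** As [reorder_exp] is biadditive, both sides sum the same term [T] over the decompositions N = P +
    Q + R; the left side is indexed by P and Q, the right side by S = P + Q and P. *)
Lemma gmulA : associative (@gmul K m d).
Proof.
move=> f g h; apply: gseriesP => N vN; rewrite !gcoefM //.
have e1 (a b c x y z : K) : a * b * x * (c * y * z) =
  a * b * c * x * y * z by ring.
have e2 (a b c x y z : K) : a * b * c * x * y * z =
  b * c * (a * x * y) * z by ring.
pose T P Q R := (-1) ^ (re P Q + re P R + re Q R) * gcoef f P * gcoef g Q
  * gcoef h R.
transitivity (\sum_(P <- ebox N) \sum_(Q <- ebox (esub N P)) T P Q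
  (esub N (eadd P Q))).
  apply: eq_big_ebox => P le_PN; rewrite gcoefM ?(evalid_le _ vN) ?ele_sub //.
  rewrite mulr_sumr; apply: eq_big_ebox => Q le_Q.
  have -> : esub (esub N P) Q = esub N (eadd P Q).
    by apply/ffunP => i; rewrite !ffunE subnDA.
  have -> : re P (esub N P) = re P Q + re P (esub N (eadd P Q)).
    rewrite -reorderDr; congr re; apply/ffunP => i.
    have := eleP _ _ le_Q i; have := eleP _ _ le_PN i.
    by rewrite !ffunE; lia.
  by rewrite /T !signzD; apply: e1.
transitivity (\sum_(S <- ebox N) \sum_(P <- ebox S) T P (esub S P) (esub N S));
  last first.
  apply: eq_big_ebox => S le_SN; rewrite gcoefM ?(evalid_le _ vN) //.
  rewrite mulr_sumr mulr_suml; apply: eq_big_ebox => P le_P.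
  have -> : re S (esub N S) = re P (esub N S) + re (esub S P) (esub N S).
    by rewrite -reorderD esubK.
  by rewrite /T !signzD; apply: e2.
transitivity (\sum_(S <- ebox N) \sum_(P <- ebox N | ele P S) T P (esub S P)
  (esub N S)); last first.
  apply: eq_big_ebox => S le_SN; rewrite -big_filter; apply: perm_big.
  apply: uniq_perm; rewrite ?filter_uniq ?ebox_uniq // => P.
  rewrite mem_filter !mem_ebox; case le_PS: (ele P S) => //=.
  exact: ele_trans le_SN.
rewrite [RHS](exchange_big_dep xpredT) //=; apply: eq_big_ebox => P le_PN.
rewrite (big_ebox_shift _ le_PN); apply: eq_big_ebox => Q le_Q.
by rewrite eaddK.
Qed.

Lemma gmulDl : left_distributive (@gmul K m d) +%R.
Proof.
move=> f g h; apply: gseriesP => N vN; rewrite gcoefD !gcoefM // -big_split.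
by apply: eq_bigr => P _; rewrite gcoefD mulrDr mulrDl.
Qed.

Lemma gmulDr : right_distributive (@gmul K m d) +%R.
Proof.
move=> f g h; apply: gseriesP => N vN; rewrite gcoefD !gcoefM // -big_split.
by apply: eq_bigr => P _; rewrite gcoefD mulrDr.
Qed.

Lemma gmulZl a f g : a *: gmul f g = gmul (a *: f) g.
Proof.
apply: gseriesP => N vN; rewrite gcoefZ !gcoefM // mulr_sumr.
by apply: eq_bigr => P _; rewrite gcoefZ (mulrCA _ a) !mulrA.
Qed.

Lemma gmulZr a f g : a *: gmul f g = gmul f (a *: g).
Proof.
apply: gseriesP => N vN; rewrite gcoefZ !gcoefM // mulr_sumr.
by apply: eq_bigr => P _; rewrite gcoefZ (mulrCA _ a).
Qed.

Definition ezero : expo := [ffun=> 0%N].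

Lemma gcoef_one N : gcoef (@gone K m d) N = (N == ezero)%:R.
Proof.
rewrite /gone (gcoef_fun (fun N => [forall i, N i == 0%N]%:R)).
have -> : [forall i, N i == 0%N] = (N == ezero).
  apply/forallP/eqP => [h|-> i]; last by rewrite ffunE.
  by apply/ffunP => i; rewrite ffunE; apply/eqP.
case: (eqVneq N ezero) => [->|_]; last by case: ifP.
rewrite ifT //; apply/evalidP => i _; by rewrite ffunE.
Qed.

Lemma reorder0 N : re ezero N = 0.
Proof.
by rewrite /reorder_exp big1 // => i _; rewrite big1 // => j _;
  rewrite ffunE !mul0r.
Qed.

Lemma reorder0r N : re N ezero = 0.
Proof.
by rewrite /reorder_exp big1 // => i _; rewrite big1 // => j _;
  rewrite ffunE !mul0r mulr0.
Qed.

Lemma ele0 N : ele ezero N.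
Proof. by apply/eleP => i; rewrite ffunE. Qed.

Lemma esub0 N : esub N ezero = N.
Proof. by apply/ffunP => i; rewrite !ffunE subn0. Qed.

Lemma gmul1 : left_id (@gone K m d) (@gmul K m d).
Proof.
move=> f; apply: gseriesP => N vN; rewrite gcoefM //.
rewrite (bigD1_seq ezero) ?mem_ebox ?ele0 ?ebox_uniq //= big1_seq =>
  [|P /andP[/negbTE h _]].
  by rewrite gcoef_one eqxx esub0 reorder0 !mul1r addr0.
by rewrite gcoef_one h mulr0 mul0r.
Qed.

Lemma gmulr1 : right_id (@gone K m d) (@gmul K m d).
Proof.
move=> f; apply: gseriesP => N vN; rewrite gcoefM // big_ebox_rev.
rewrite (bigD1_seq ezero) ?mem_ebox ?ele0 ?ebox_uniq //= big1_seq.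
  by rewrite esubKK ?ele0 // esub0 gcoef_one eqxx reorder0r mul1r mulr1 addr0.
move=> P /andP[/negbTE h]; rewrite mem_ebox => le_PN.
by rewrite esubKK // gcoef_one h mulr0.
Qed.

Lemma gone_neq0 : @gone K m d != 0.
Proof.
apply/eqP => /(congr1 (fun f => gcoef f ezero)) /eqP.
by rewrite gcoef_one gcoef0 eqxx oner_eq0.
Qed.

HB.instance Definition _ := GRing.Zmodule_isNzRing.Build G
  gmulA gmul1 gmulr1 gmulDl gmulDr gone_neq0.
HB.instance Definition _ := GRing.Lmodule_isLalgebra.Build K G gmulZl.
HB.instance Definition _ := GRing.Lalgebra_isAlgebra.Build K G gmulZr.

End SeriesRing.

(** * Homogeneous series and derivatives *)

Section Homogeneous.
Variables (K : fieldType) (m : nat) (d : 'I_m -> int).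
Local Notation expo := {ffun 'I_m -> nat}.
Local Notation G := (gseries K d).
Local Notation re := (reorder_exp d).
Local Notation edeg := (expdeg d).
Implicit Types (f g h : G) (P Q N S : expo) (M : gmon d).

Lemma ghomogP k f : ghomog k f <-> forall N, gcoef f N != 0 -> edeg N = k.
Proof.
split=> [h N|h M]; last by rewrite -gcoef_val => /h.
by rewrite /gcoef; case: insubP => [M _ <- /h //|]; rewrite eqxx.
Qed.

Lemma gcoef_ghcomp k f N :
  gcoef (ghcomp k f) N = if edeg N == k then gcoef f N else 0.
Proof.
by rewrite /gcoef; case: insubP => [M _ <-|_] //; case: ifP.
Qed.

Lemma ghomog_ghcomp k f : ghomog k (ghcomp k f).
Proof.
by apply/ghomogP => N; rewrite gcoef_ghcomp; case: (edeg N =P k) => // _;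
  rewrite eqxx.
Qed.

Lemma ghcomp_id k f : ghomog k f -> ghcomp k f = f.
Proof.
move/ghomogP => h; apply: gseriesP => N _; rewrite gcoef_ghcomp.
by case: eqP => // /eqP hN; apply/esym/eqP; apply: contraNT hN => /h ->.
Qed.

Lemma ghomogE k f : ghomog k f <-> ghcomp k f = f.
Proof. by split=> [/ghcomp_id //|<-]; exact: ghomog_ghcomp. Qed.

Lemma ghcomp_homog k l f : ghomog l f -> ghcomp k f = if k == l then f else 0.
Proof.
move=> /ghomogP hf; apply: gseriesP => N _; rewrite gcoef_ghcomp.
have [e|/hf ->] := eqVneq (gcoef f N) 0.
  by case: (k == l); rewrite ?gcoef0 e; case: ifP.
by rewrite eq_sym; case: (k == l); rewrite ?gcoef0.
Qed.

Lemma ghcomp_is_linear k : linear (@ghcomp K m d k).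
Proof.
move=> a f g; apply: gseriesP => N _;
  rewrite gcoefD gcoefZ !gcoef_ghcomp gcoefD gcoefZ.
by case: ifP => _; rewrite ?mulr0 ?addr0.
Qed.
HB.instance Definition _ k :=
  GRing.isLinear.Build K G G _ (@ghcomp K m d k) (ghcomp_is_linear k).

Lemma ghomogZ k a f : ghomog k f -> ghomog k (a *: f).
Proof. by move=> /ghomogE hf; apply/ghomogE; rewrite linearZ /= hf. Qed.

Lemma ghomogD k f g : ghomog k f -> ghomog k g -> ghomog k (f + g).
Proof.
by move=> /ghomogE hf /ghomogE hg; apply/ghomogE; rewrite linearD /= hf hg.
Qed.

Lemma ghomog0 k : ghomog k (0 : G).
Proof. by apply/ghomogE; rewrite linear0. Qed.

Lemma ghomog_eq0 k l f : k != l -> ghomog k f -> ghomog l f -> f = 0.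
Proof.
move=> /negbTE kl /(ghcomp_homog l); rewrite eq_sym kl => f0 /ghcomp_id <-.
exact: f0.
Qed.

(** Only splittings of N whose second part has degree l contribute. Since f is arbitrary, degree
    components of an inhomogeneous polyvector field can later be taken through contractions. *)
Lemma ghcompM k l f g : ghomog l g -> ghcomp (k + l) (f * g) = ghcomp k f * g.
Proof.
move=> /ghomogP hg; apply: gseriesP => N vN; rewrite gcoef_ghcomp !gcoefM //.
have [hN|hN] := eqVneq (edeg N) (k + l); last first.
  symmetry; rewrite big1_seq // => P; rewrite mem_ebox => /= le_PN.
  rewrite gcoef_ghcomp; case: eqP => [hP|]; last by rewrite mulr0 mul0r.
  have [->|/hg hQ] := eqVneq (gcoef g (esub N P)) 0; first by rewrite mulr0.
  by case/eqP: hN; rewrite -hP -hQ -edegD esubK.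
apply: eq_big_ebox => P le_PN; rewrite gcoef_ghcomp.
case: eqP => // /eqP hP; have [->|/hg hQ] := eqVneq (gcoef g (esub N P)) 0.
  by rewrite !mulr0.
by case/eqP: hP; apply: (addIr l); rewrite -hN -hQ -edegD esubK.
Qed.

Lemma ghomogM k l f g : ghomog k f -> ghomog l g -> ghomog (k + l) (f * g).
Proof. by move=> /ghomogE hf hg; apply/ghomogE; rewrite ghcompM // hf. Qed.

Lemma ghomog1 : ghomog 0 (1 : G).
Proof.
apply/ghomogP => N; rewrite gcoef_one; case: (N =P ezero m) => [-> _|_];
  last by rewrite eqxx.
by rewrite /expdeg big1 // => i _; rewrite ffunE mul0r.
Qed.

(** The product of degrees sums over all pairs of variables. Off the diagonal it gives the two
    reordering exponents; a diagonal term is even, because validity of P + Q forbids an odd variable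
    to occur in both P and Q. *)
Lemma re_swap P Q : evalid d (eadd P Q) ->
  (-1) ^ re P Q = (-1) ^ (edeg P * edeg Q + re Q P) :> K.
Proof.
move=> /evalidP vPQ; pose D i j := (P i)%:Z * d i * ((Q j)%:Z * d j).
have -> : edeg P * edeg Q = re P Q + re Q P + \sum_i D i i.
  have -> : re Q P = \sum_(i < m) \sum_(j < m | (i < j)%N) D i j.
    rewrite /reorder_exp (exchange_big_dep xpredT) //=.
    by apply: eq_bigr => i _; apply: eq_bigr => j _; rewrite /D; ring.
  rewrite -!big_split /= mulr_suml; apply: eq_bigr => i _.
  rewrite mulr_sumr (bigID (fun j : 'I_m => (j < i)%N)) /= -!addrA;
    congr (_ + _).
  rewrite (bigD1 i) ?ltnn //= addrC; congr (_ + _); apply: eq_bigl => j.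
  by rewrite -leqNgt ltn_neqAle andbC eq_sym.
have hD : oddz (\sum_i D i i) = false.
  apply: (big_ind (fun x => oddz x = false)) => // [x y hx hy|i _];
    first by rewrite oddzD hx hy.
  rewrite /D !oddzE; case di: (oddz (d i)); rewrite ?andbF //= !andbT.
  by have := vPQ i di; rewrite ffunE; case: (P i) (Q i) => [|[|?]] [|?].
rewrite !signz_odd !oddzE hD; case: (oddz _); case: (oddz _) => //.
Qed.

Lemma gmulC k l f g : ghomog k f -> ghomog l g ->
  f * g = (-1) ^ (k * l) *: (g * f).
Proof.
move=> /ghomogP hf /ghomogP hg; apply: gseriesP => N vN.
rewrite gcoefZ !gcoefM // big_ebox_rev mulr_sumr; apply: eq_big_ebox => Q le_Q.
rewrite esubKK //.
have [->|/hf hP] := eqVneq (gcoef f (esub N Q)) 0;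
  first by rewrite !(mulr0, mul0r).
have [->|/hg <-] := eqVneq (gcoef g Q) 0; first by rewrite !(mulr0, mul0r).
rewrite re_swap -?hP; last by rewrite eaddC esubK.
by rewrite signzD -!mulrA; congr (_ * (_ * _)); rewrite mulrC.
Qed.

Definition edelta i : expo := [ffun j => nat_of_bool (j == i)].

(** [lsg] and [rsg] are the sign exponents of [gderl] and [gderr]. By [re_deltal] and [re_deltar]
    they also reorder a single x_i against a monomial, which links derivatives to products. *)
Definition lsg i N : int := d i * \sum_(j < m | (j < i)%N) (N j)%:Z * d j.
Definition rsg i N : int := d i * \sum_(j < m | (i < j)%N) (N j)%:Z * d j.

Lemma lsgD i P Q : lsg i (eadd P Q) = lsg i P + lsg i Q.
Proof.
rewrite /lsg -mulrDr -big_split; congr (_ * _).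
by apply: eq_bigr => j _ /=; rewrite ffunE PoszD mulrDl.
Qed.

Lemma rsgD i P Q : rsg i (eadd P Q) = rsg i P + rsg i Q.
Proof.
rewrite /rsg -mulrDr -big_split; congr (_ * _).
by apply: eq_bigr => j _ /=; rewrite ffunE PoszD mulrDl.
Qed.

Lemma sum_edelta (p : pred 'I_m) i :
  \sum_(j < m | p j) (edelta i j)%:Z * d j = (p i)%:Z * d i.
Proof.
case pi: (p i).
  rewrite (bigD1 i) //= ffunE eqxx mul1r big1 ?addr0 ?mul1r // => j
    /andP[_ /negbTE ji].
  by rewrite ffunE ji mul0r.
rewrite mul0r big1 // => j pj; rewrite ffunE.
by case: (j =P i) => [ji|_]; [rewrite -ji pj in pi | rewrite mul0r].
Qed.

Lemma lsg_delta i j : lsg i (edelta j) = d i * ((j < i)%N%:Z * d j).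
Proof. by rewrite /lsg sum_edelta. Qed.

Lemma rsg_delta i j : rsg i (edelta j) = d i * ((i < j)%N%:Z * d j).
Proof. by rewrite /rsg sum_edelta. Qed.

Lemma edeg_delta i : edeg (edelta i) = d i.
Proof. by rewrite /expdeg sum_edelta mul1r. Qed.

Lemma re_deltal i Q : re (edelta i) Q = lsg i Q.
Proof.
rewrite /reorder_exp (bigD1 i) //= [X in _ + X]big1 ?addr0 => [|j /negbTE ji];
  last first.
  by rewrite big1 // => k _; rewrite ffunE ji !mul0r.
by rewrite /lsg mulr_sumr; apply: eq_bigr => j _; rewrite ffunE eqxx mul1r.
Qed.

Lemma re_deltar i P : re P (edelta i) = rsg i P.
Proof.
rewrite /reorder_exp (exchange_big_dep xpredT) //= (bigD1 i) //=.
rewrite [X in _ + X]big1 ?addr0 => [|j /negbTE ji]; last first.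
  by rewrite big1 // => k _; rewrite ffunE ji !mul0r mulr0.
rewrite /rsg mulr_sumr; apply: eq_bigr => j _.
by rewrite ffunE eqxx mul1r mulrC.
Qed.

Lemma edeg_split i P :
  d i * edeg P = lsg i P + d i * ((P i)%:Z * d i) + rsg i P.
Proof.
rewrite /lsg /rsg -!mulrDr /expdeg; congr (_ * _).
rewrite (bigID (fun j : 'I_m => (j < i)%N)) /= -addrA; congr (_ + _).
rewrite (bigD1 i) ?ltnn //=; congr (_ + _); apply: eq_bigl => j.
by rewrite -leqNgt ltn_neqAle andbC eq_sym.
Qed.

Lemma mincrE N i : mincr N i = eadd N (edelta i).
Proof. by apply/ffunP => j; rewrite !ffunE. Qed.

Lemma gcoef_shift0 f N i : ~~ evalid d N -> gcoef f (eadd N (edelta i)) = 0.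
Proof.
move=> vN; apply: gcoef_invalid; apply: contra vN; apply: evalid_le;
  exact: ele_addr.
Qed.

Lemma gcoef_derl i f N : gcoef (gderl i f) N =
  (-1) ^ lsg i N * (N i).+1%:R * gcoef f (eadd N (edelta i)).
Proof.
rewrite /gderl (gcoef_fun d
  (fun N => (-1) ^ lsg i N * (N i).+1%:R * gcoef f (mincr N i))).
by rewrite mincrE; case: ifP => // /negbT vN; rewrite gcoef_shift0 // mulr0.
Qed.

Lemma gcoef_derr i f N : gcoef (gderr i f) N =
  (-1) ^ rsg i N * (N i).+1%:R * gcoef f (eadd N (edelta i)).
Proof.
rewrite /gderr (gcoef_fun d
  (fun N => (-1) ^ rsg i N * (N i).+1%:R * gcoef f (mincr N i))).
by rewrite mincrE; case: ifP => // /negbT vN; rewrite gcoef_shift0 // mulr0.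
Qed.

Lemma gderl_is_linear i : linear (@gderl K m d i).
Proof.
move=> a f g; apply: gseriesP => N _; rewrite gcoefD gcoefZ !gcoef_derl.
by rewrite gcoefD gcoefZ mulrDr mulrCA.
Qed.
HB.instance Definition _ i :=
  GRing.isLinear.Build K G G _ (@gderl K m d i) (gderl_is_linear i).

Lemma gderr_is_linear i : linear (@gderr K m d i).
Proof.
move=> a f g; apply: gseriesP => N _; rewrite gcoefD gcoefZ !gcoef_derr.
by rewrite gcoefD gcoefZ mulrDr mulrCA.
Qed.
HB.instance Definition _ i :=
  GRing.isLinear.Build K G G _ (@gderr K m d i) (gderr_is_linear i).

Lemma ghcomp_derr k i f : ghcomp (k - d i) (gderr i f) = gderr i (ghcomp k f).
Proof.
apply: gseriesP => N _;
  rewrite gcoef_derr !gcoef_ghcomp gcoef_derr edegD edeg_delta.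
by rewrite eq_sym subr_eq eq_sym; case: ifP => // _; rewrite mulr0.
Qed.

Lemma ghomog_derr k i f : ghomog k f -> ghomog (k - d i) (gderr i f).
Proof. by move=> /ghomogE h; apply/ghomogE; rewrite ghcomp_derr h. Qed.

Lemma ghcomp_derl k i f : ghcomp (k - d i) (gderl i f) = gderl i (ghcomp k f).
Proof.
apply: gseriesP => N _;
  rewrite gcoef_derl !gcoef_ghcomp gcoef_derl edegD edeg_delta.
by rewrite eq_sym subr_eq eq_sym; case: ifP => // _; rewrite mulr0.
Qed.

Lemma ghomog_derl k i f : ghomog k f -> ghomog (k - d i) (gderl i f).
Proof. by move=> /ghomogE h; apply/ghomogE; rewrite ghcomp_derl h. Qed.

Lemma gderlrC i j f : gderl i (gderr j f) = gderr j (gderl i f).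
Proof.
apply: gseriesP => N _;
  rewrite !(gcoef_derl, gcoef_derr) -!eaddA (eaddC (edelta j)).
rewrite !lsgD !rsgD rsg_delta lsg_delta !signzD !ffunE eq_sym [d j * _]mulrCA
  [d i * _]mulrCA.
rewrite (mulrC (d j)); set a := (-1) ^ lsg i N; set b := (-1) ^ rsg j N;
  set e := (-1) ^ _.
set x := gcoef _ _; have [->|_] := eqVneq i j; first by rewrite /= !mulrA; ring.
by rewrite !addn0; ring.
Qed.

Lemma gcoef_shift2 f N i : oddz (d i) ->
  gcoef f (eadd N (eadd (edelta i) (edelta i))) = 0.
Proof.
move=> di; apply: gcoef_invalid; apply/negP => /evalidP /(_ i di).
by rewrite !ffunE eqxx; lia.
Qed.

Lemma gderrC i j f : gderr i (gderr j f) =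
  (-1) ^ (d i * d j) *: gderr j (gderr i f).
Proof.
apply: gseriesP => N _; rewrite gcoefZ !gcoef_derr -!eaddA.
have [<-|ij] := eqVneq i j.
  case di: (oddz (d i)); first by rewrite gcoef_shift2 // !mulr0.
  by rewrite [(-1) ^ (d i * d i)]signz_odd oddzM di /= expr0 mul1r.
rewrite (eaddC (edelta j)) !rsgD !rsg_delta !ffunE (negbTE ij) eq_sym
  (negbTE ij) !addn0.
have -> : (-1) ^ (rsg j N + d j * ((j < i)%N%:Z * d i)) =
  (-1) ^ (d i * d j) * (-1) ^ rsg j N
    * (-1) ^ (d i * ((i < j)%N%:Z * d j)) :> K.
  rewrite -!signzD; have [ltij|ltji|/val_inj/eqP] := ltngtP i j;
    [ | | by rewrite (negbTE ij)];
  sign_eq.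
by rewrite !signzD; ring.
Qed.

Lemma gderlC i j f : gderl i (gderl j f) =
  (-1) ^ (d i * d j) *: gderl j (gderl i f).
Proof.
apply: gseriesP => N _; rewrite gcoefZ !gcoef_derl -!eaddA.
have [<-|ij] := eqVneq i j.
  case di: (oddz (d i)); first by rewrite gcoef_shift2 // !mulr0.
  by rewrite [(-1) ^ (d i * d i)]signz_odd oddzM di /= expr0 mul1r.
rewrite (eaddC (edelta j)) !lsgD !lsg_delta !ffunE (negbTE ij) eq_sym
  (negbTE ij) !addn0.
have -> : (-1) ^ (lsg j N + d j * ((i < j)%N%:Z * d i)) =
  (-1) ^ (d i * d j) * (-1) ^ lsg j N
    * (-1) ^ (d i * ((j < i)%N%:Z * d j)) :> K.
  rewrite -!signzD; have [ltij|ltji|/val_inj/eqP] := ltngtP i j;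
    [ | | by rewrite (negbTE ij)];
  sign_eq.
by rewrite !signzD; ring.
Qed.

(* At an odd variable [x_i] with exponent 1 in [N], the product [f * g] has no
   coefficient at [N + e_i], while the two terms of the product rule cancel;
   [u] and [v] tell which term carries the sign. *)
Lemma gder_weight (u v : bool) i N P f g : u != v -> evalid d N ->
  ele P (eadd N (edelta i)) ->
  let Q := esub (eadd N (edelta i)) P in
  (-1) ^ (u%:Z * (d i * ((Q i)%:Z * d i))) * (P i)%:R
    * (gcoef f P * gcoef g Q) +
  (-1) ^ (v%:Z * (d i * ((P i)%:Z * d i))) * (Q i)%:R
    * (gcoef f P * gcoef g Q) =
  if evalid d (eadd N (edelta i))
  then (N i).+1%:R * (gcoef f P * gcoef g Q) else 0.
Proof.
move=> uv vN le_P Q.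
have hPQ : (P i + Q i = (N i).+1)%N.
  by have := eleP _ _ le_P i; rewrite /Q !ffunE eqxx; lia.
have [->|nz] := eqVneq (gcoef f P * gcoef g Q) 0.
  by rewrite !mulr0 addr0; case: ifP.
rewrite -mulrDl !signz_odd !oddzE.
case di: (oddz (d i)); last first.
  rewrite ifT; first by rewrite /= ?andbF !expr0 !mul1r -natrD hPQ.
  apply/evalidP => j dj; have /evalidP/(_ j dj) := vN.
  by rewrite !ffunE; case: eqP => [ji|_]; rewrite ?addn0 // -ji dj in di *.
have vP : (P i <= 1)%N.
  apply: contraR nz => hP; rewrite gcoef_invalid ?mul0r //.
  by apply: contra hP => /evalidP /(_ i di).
have vQ : (Q i <= 1)%N.
  apply: contraR nz => hQ; rewrite [gcoef g Q]gcoef_invalid ?mulr0 //.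
  by apply: contra hQ => /evalidP /(_ i di).
case: ifP => [/evalidP /(_ i di)|/negbT vN'].
  rewrite {1}/eadd {1}/edelta ffunE [in X in (_ + X)%N]ffunE eqxx => hN.
  have -> : N i = 0%N by lia.
  have [[-> ->]|[-> ->]] : (P i = 0 /\ Q i = 1)%N \/ (P i = 1 /\ Q i = 0)%N
    by lia.
    by rewrite /= ?andbF mulr0 add0r expr0 mulr1.
  by rewrite /= ?andbF mulr0 addr0 expr0 mulr1.
have hN : N i = 1%N.
  have /evalidP/(_ i di) := vN; case hN : (N i) => [|[|//]] // _.
  case/negP: vN'; apply/evalidP => j dj; have /evalidP/(_ j dj) := vN.
  by rewrite !ffunE; case: eqP => [->|_]; rewrite ?hN ?addn0.
have [-> ->] : (P i = 1 /\ Q i = 1)%N by lia.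
by case: u uv; case: v => //= _; rewrite expr0 expr1 !mulr1 ?subrr ?addNr mul0r.
Qed.

(** The common coefficient form of both product rules. In each summand one factor supplies the extra
    x_i. The flag that is set marks the summand where the derivation also crosses the powers of x_i
    in the other factor: [v] for derivatives from the left, [u] from the right. *)
Lemma gcoefM_shift (u v : bool) i N f g : u != v -> evalid d N ->
  (N i).+1%:R * gcoef (f * g) (eadd N (edelta i)) =
  \sum_(P <- ebox N)
    ((-1) ^ (re (eadd P (edelta i)) (esub N P)
             + u%:Z * (d i * ((esub N P i)%:Z * d i)))
       * (P i).+1%:R * (gcoef f (eadd P (edelta i)) * gcoef g (esub N P))
     + (-1) ^ (re P (eadd (esub N P) (edelta i)) + v%:Z
       * (d i * ((P i)%:Z * d i)))
       * (esub N P i).+1%:R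
         * (gcoef f P * gcoef g (eadd (esub N P) (edelta i)))).
Proof.
move=> uv vN; set N' := eadd N (edelta i).
have le_dN : ele (edelta i) N' by rewrite /N' eaddC ele_addr.
have subN' : esub N' (edelta i) = N by rewrite /N' eaddC eaddK.
(* The integer weight S_i kills the terms without x_i; those left are S = P + e_i with P in the box
   of N. *)
have shiftE (F : expo -> K) : (forall S, S i = 0%N -> F S = 0) ->
    \sum_(S <- ebox N') F S = \sum_(P <- ebox N) F (eadd P (edelta i)).
  move=> F0; rewrite (bigID (ele (edelta i))) /= big_ebox_shift // subN'.
  rewrite [X in _ + X]big1 => [|S /forallPn[j]]; last first.
    by rewrite ffunE; case: eqP => [->|_];
      rewrite -?eqn0Ngt ?lt0n ?negbK => // /eqP /F0.
  by rewrite addr0; apply: eq_bigr => P _; rewrite eaddC.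
(* In [F1] the extra x_i comes from f, in [F2] from g; accordingly S is the exponent of f in [F1]
   and of g in [F2]. *)
pose F1 S := (-1) ^ (re S (esub N' S) + u%:Z * (d i * ((esub N' S i)%:Z * d i)))
       * (S i)%:R * (gcoef f S * gcoef g (esub N' S)).
pose F2 S := (-1) ^ (re (esub N' S) S + v%:Z * (d i * ((esub N' S i)%:Z * d i)))
       * (S i)%:R * (gcoef f (esub N' S) * gcoef g S).
have eS P : ele P N -> esub N' (eadd P (edelta i)) = esub N P.
  move=> /eleP le_P; apply/ffunP => j; have := le_P j; rewrite !ffunE; lia.
rewrite big_split /=.
transitivity (\sum_(S <- ebox N') F1 S + \sum_(S <- ebox N') F2 S).
  rewrite [X in _ + X]big_ebox_rev -big_split /=.
  transitivity (\sum_(P <- ebox N') (if evalid d N' then (N i).+1%:R *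
     ((-1) ^ re P (esub N' P) * (gcoef f P * gcoef g (esub N' P))) else 0)).
    case: (boolP (evalid d N')) => vN'; last first.
      by rewrite big1 // gcoef_invalid // mulr0.
    by rewrite gcoefM // mulr_sumr; apply: eq_bigr => P _; rewrite !mulrA.
  apply: eq_big_ebox => P le_P; have := gder_weight f g uv vN le_P.
  rewrite /F1 /F2 esubKK // -/N' /= => e.
  transitivity ((-1) ^ re P (esub N' P) * (if evalid d N'
      then (N i).+1%:R * (gcoef f P * gcoef g (esub N' P)) else 0)).
    by case: ifP => _; [rewrite mulrCA | rewrite mulr0].
  by rewrite -e mulrDr !signzD !mulrA.
congr (_ + _).
  rewrite shiftE => [|S S0]; last by rewrite /F1 S0 mulr0 mul0r.
  by apply: eq_big_ebox => P le_P;
    rewrite /F1 eS // [in X in X%:R]ffunE [edelta i i]ffunE eqxx addn1.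
rewrite shiftE => [|S S0]; last by rewrite /F2 S0 mulr0 mul0r.
rewrite [RHS]big_ebox_rev; apply: eq_big_ebox => P le_P.
by rewrite /F2 eS // esubKK // [in X in X%:R]ffunE [edelta i i]ffunE eqxx addn1.
Qed.

End Homogeneous.

(** * Derivations, and the inclusion of functions into polyvector fields *)

Section Derivations.
Variables (K : fieldType) (m : nat) (d : 'I_m -> int).
Local Notation G := (gseries K d).
Implicit Types (f g h : G).

Lemma gderlM p i f g : ghomog p f ->
  gderl i (f * g) = gderl i f * g + (-1) ^ (d i * p) *: (f * gderl i g).
Proof.
move=> /ghomogP hf; apply: gseriesP => N vN.
rewrite gcoefD gcoefZ gcoef_derl -mulrA (@gcoefM_shift _ _ _ false true) //
  !gcoefM //.
rewrite !mulr_sumr -big_split; apply: eq_big_ebox => P le_P /=.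
have lN : lsg d i N = lsg d i P + lsg d i (esub N P) by rewrite -lsgD esubK.
rewrite !gcoef_derl mulrDr reorderD reorderDr re_deltal re_deltar lN.
have e1 (a1 a2 b1 b2 n x y : K) : a1 * a2 = b1 * b2 ->
    a1 * (a2 * n * (x * y)) = b1 * (b2 * n * x) * y.
  by move=> e; rewrite !mulrA e.
have e2 (a1 a2 b1 b2 b3 n x y : K) : a1 * a2 = b1 * b2 * b3 ->
    a1 * (a2 * n * (x * y)) = b1 * (b2 * x * (b3 * n * y)).
  by move=> e; rewrite !mulrA e; ring.
congr (_ + _); first by apply: e1; rewrite -!signzD; sign_eq.
have [->|hP] := eqVneq (gcoef f P) 0; first by rewrite !(mul0r, mulr0).
(* A nonzero coefficient forces P to have degree p, so the parts of x^P before, at and after x_i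
   together give the sign exponent d_i p. *)
have e := edeg_split d i P; rewrite (hf _ hP) in e.
by apply: e2; rewrite -!signzD e; sign_eq.
Qed.

Lemma gderrM q i f g : ghomog q g ->
  gderr i (f * g) = f * gderr i g + (-1) ^ (d i * q) *: (gderr i f * g).
Proof.
move=> /ghomogP hg; apply: gseriesP => N vN.
rewrite gcoefD gcoefZ gcoef_derr -mulrA (@gcoefM_shift _ _ _ true false) //
  !gcoefM //.
rewrite !mulr_sumr -big_split; apply: eq_big_ebox => P le_P /=.
have rN : rsg d i N = rsg d i P + rsg d i (esub N P) by rewrite -rsgD esubK.
rewrite !gcoef_derr mulrDr reorderD reorderDr re_deltal re_deltar rN [LHS]addrC.
have e1 (a1 a2 b1 b2 n x y : K) : a1 * a2 = b1 * b2 ->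
    a1 * (a2 * n * (x * y)) = b1 * x * (b2 * n * y).
  by move=> e; rewrite !mulrA e; ring.
have e2 (a1 a2 b1 b2 b3 n x y : K) : a1 * a2 = b1 * b2 * b3 ->
    a1 * (a2 * n * (x * y)) = b1 * (b2 * (b3 * n * x) * y).
  by move=> e; rewrite !mulrA e.
congr (_ + _); first by apply: e1; rewrite -!signzD; sign_eq.
have [->|hQ] := eqVneq (gcoef g (esub N P)) 0; first by rewrite !(mul0r, mulr0).
have e := edeg_split d i (esub N P); rewrite (hg _ hQ) in e.
by apply: e2; rewrite -!signzD e; sign_eq.
Qed.

Lemma evalid_delta i : evalid d (edelta i).
Proof. by apply/evalidP => j _; rewrite ffunE leq_b1. Qed.

Lemma gcoef_gvar i N : gcoef (gvar K i : G) N = (N == edelta i)%:R.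
Proof.
rewrite /gvar (gcoef_fun d (fun N => [forall j, N j == (j == i)]%:R)).
have -> : [forall j, N j == (j == i)] = (N == edelta i).
  apply/forallP/eqP => [h|-> j]; last by rewrite ffunE.
  by apply/ffunP => j; rewrite ffunE; apply/eqP.
by case: eqP => [->|_]; rewrite ?evalid_delta //; case: ifP.
Qed.

Lemma ghomog_gvar i : ghomog (d i) (gvar K i : G).
Proof.
apply/ghomogP => N; rewrite gcoef_gvar; case: (N =P edelta i) => [-> _|_].
  exact: edeg_delta.
by rewrite eqxx.
Qed.

Lemma eadd_delta_eq i j (N : {ffun 'I_m -> nat}) :
  (eadd N (edelta i) == edelta j) = (i == j) && (N == ezero m).
Proof.
apply/eqP/andP => [/ffunP h|[/eqP -> /eqP ->]]; last first.
  by apply/ffunP => k; rewrite !ffunE.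
have ij : i = j.
  by have := h i; rewrite !ffunE eqxx; case: eqP => // _; lia.
split; first exact/eqP; apply/eqP/ffunP => k.
have := h k; rewrite !ffunE ij; case: (k == j) => /=; lia.
Qed.

Lemma gderl_var i j : gderl i (gvar K j : G) = (i == j)%:R.
Proof.
apply: gseriesP => N vN; rewrite gcoef_derl gcoef_gvar eadd_delta_eq.
case: (i == j); last by rewrite mulr0 gcoef0.
rewrite gcoef_one; case: eqP => [->|]; last by rewrite mulr0.
by rewrite /lsg ffunE big1 ?mulr0 ?expr0z ?mulr1 // => k _; rewrite ffunE mul0r.
Qed.

Lemma gderr_var i j : gderr i (gvar K j : G) = (i == j)%:R.
Proof.
apply: gseriesP => N vN; rewrite gcoef_derr gcoef_gvar eadd_delta_eq.
case: (i == j); last by rewrite mulr0 gcoef0.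
rewrite gcoef_one; case: eqP => [->|]; last by rewrite mulr0.
by rewrite /rsg ffunE big1 ?mulr0 ?expr0z ?mulr1 // => k _; rewrite ffunE mul0r.
Qed.

End Derivations.

Section Weights.
Variables (K : fieldType) (m : nat) (dV : 'I_m -> int).
Local Notation td := (tdeg dV).
Local Notation pd := (pvdeg dV).
Local Notation O := (gseries K td).
Local Notation P := (gseries K pd).
Local Notation expo n := {ffun 'I_n -> nat}.
Implicit Types (f g : O) (A B : P) (N S : expo (m + m)).

Definition eweight N : nat := (\sum_(a < m) N (psivar a))%N.
Definition eres N : expo m := [ffun a => N (tvar a)].
Definition eext (Q : expo m) : expo (m + m) :=
  [ffun i => if fintype.split i is inl a then Q a else 0%N].

Lemma split_tvar a : fintype.split (tvar a : 'I_(m + m)) = inl a.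
Proof. exact: (unsplitK (inl a)). Qed.

Lemma split_psivar a : fintype.split (psivar a : 'I_(m + m)) = inr a.
Proof. exact: (unsplitK (inr a)). Qed.

Lemma pvdeg_tvar a : pd (tvar a) = td a.
Proof. by rewrite /pvdeg split_tvar. Qed.

Lemma pvdeg_psivar a : pd (psivar a) = 1 - td a.
Proof. by rewrite /pvdeg split_psivar. Qed.

Lemma var_case (p : 'I_(m + m) -> Prop) :
  (forall a, p (tvar a)) -> (forall a, p (psivar a)) -> forall i, p i.
Proof.
move=> ht hp i; case: (fintype.splitP i) => a e.
  by have -> : i = tvar a by exact: val_inj.
by have -> : i = psivar a by exact: val_inj.
Qed.

Lemma eext_tvar Q a : eext Q (tvar a) = Q a.
Proof. by rewrite ffunE split_tvar. Qed.

Lemma eext_psivar Q a : eext Q (psivar a) = 0%N.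
Proof. by rewrite ffunE split_psivar. Qed.

Lemma eweight_ext Q : eweight (eext Q) = 0%N.
Proof. by rewrite /eweight big1 // => a _; rewrite eext_psivar. Qed.

Lemma eextK Q : eres (eext Q) = Q.
Proof. by apply/ffunP => a; rewrite ffunE eext_tvar. Qed.

Lemma eresK N : eweight N = 0%N -> eext (eres N) = N.
Proof.
move=> /eqP; rewrite sum_nat_eq0 => /forallP h; apply/ffunP;
  apply: var_case => a.
  by rewrite eext_tvar ffunE.
by rewrite eext_psivar (eqP (implyP (h a) isT)).
Qed.

Lemma eweightD N S : eweight (eadd N S) = (eweight N + eweight S)%N.
Proof.
by rewrite /eweight -big_split; apply: eq_bigr => a _; rewrite ffunE.
Qed.

Lemma eweight_tvar a : eweight (edelta (tvar a)) = 0%N.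
Proof. by rewrite /eweight big1 // => b _; rewrite ffunE eq_rlshift. Qed.

Lemma eweight_psivar a : eweight (edelta (psivar a)) = 1%N.
Proof.
rewrite /eweight (bigD1 a) //= big1 => [|b /negbTE h];
  first by rewrite ffunE eqxx.
by rewrite ffunE eq_rshift h.
Qed.

Lemma evalid_ext Q : evalid pd (eext Q) = evalid td Q.
Proof.
apply/evalidP/evalidP => h.
  by move=> a; have := h (tvar a); rewrite eext_tvar pvdeg_tvar.
by apply: var_case => a; rewrite ?eext_tvar ?eext_psivar // pvdeg_tvar;
  apply: h.
Qed.

Lemma edeg_ext Q : expdeg pd (eext Q) = expdeg td Q.
Proof.
rewrite /expdeg big_split_ord /= [X in _ + X]big1 ?addr0 => [|a _].
  by apply: eq_bigr => a _; rewrite eext_tvar pvdeg_tvar.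
by rewrite eext_psivar mul0r.
Qed.

Lemma lsg_ext a Q : lsg pd (tvar a) (eext Q) = lsg td a Q.
Proof.
rewrite /lsg pvdeg_tvar big_mkcond big_split_ord /= -!big_mkcond /=.
rewrite [X in _ + X]big1 ?addr0 => [|b _]; last by rewrite eext_psivar mul0r.
by congr (_ * _); apply: eq_bigr => b _; rewrite eext_tvar pvdeg_tvar.
Qed.

Lemma re_ext Q R : reorder_exp pd (eext Q) (eext R) = reorder_exp td Q R.
Proof.
rewrite /reorder_exp big_split_ord /= [X in _ + X]big1 ?addr0 => [|a _];
  last first.
  by rewrite big1 // => b _; rewrite eext_psivar !mul0r.
apply: eq_bigr => a _; have e := lsg_ext a R; rewrite /lsg pvdeg_tvar in e.
by rewrite -!mulr_sumr eext_tvar pvdeg_tvar -!mulrA e.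
Qed.

Lemma gcoef_wcomp n A N :
  gcoef (pv_wcomp n A) N = if eweight N == n then gcoef A N else 0.
Proof. by rewrite /gcoef; case: insubP => [M _ <-|_] //; case: ifP. Qed.

Lemma gcoef_OV_PV f N :
  gcoef (OV_PV f) N = if eweight N == 0%N then gcoef f (eres N) else 0.
Proof.
rewrite /OV_PV (gcoef_fun pd
  (fun N => if eweight N == 0%N then gcoef f (eres N) else 0)).
case: eqP => w0; last by case: ifP.
by case: ifP => // /negbT;
  rewrite -(eresK w0) evalid_ext eextK => /gcoef_invalid ->.
Qed.

Lemma pv_wcomp_is_linear n : linear (@pv_wcomp K m dV n).
Proof.
move=> a A B; apply: gseriesP => N _.
by rewrite gcoefD gcoefZ !gcoef_wcomp gcoefD gcoefZ; case: ifP => // _;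
  rewrite mulr0 addr0.
Qed.
HB.instance Definition _ n :=
  GRing.isLinear.Build K P P _ (@pv_wcomp K m dV n) (pv_wcomp_is_linear n).

Lemma OV_PV_is_linear : linear (@OV_PV K m dV).
Proof.
move=> a f g; apply: gseriesP => N _.
by rewrite gcoefD gcoefZ !gcoef_OV_PV gcoefD gcoefZ; case: ifP => // _;
  rewrite mulr0 addr0.
Qed.
HB.instance Definition _ :=
  GRing.isLinear.Build K O P _ (@OV_PV K m dV) OV_PV_is_linear.

Lemma OV_PV_inj : injective (@OV_PV K m dV).
Proof.
move=> f g e; apply: gseriesP => Q _.
by have := congr1 (fun A => gcoef A (eext Q)) e;
  rewrite !gcoef_OV_PV eweight_ext eextK.
Qed.

Lemma pv_wcomp0_OV_PV f : pv_wcomp 0 (OV_PV f) = OV_PV f.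
Proof.
by apply: gseriesP => N _; rewrite gcoef_wcomp gcoef_OV_PV;
  case: (eweight N == 0%N).
Qed.

(** Weights are additive and nonnegative, so a product of weight zero has both factors of weight
    zero. *)
Lemma pv_wcomp0M A B : pv_wcomp 0 (A * B) = pv_wcomp 0 A * pv_wcomp 0 B.
Proof.
apply: gseriesP => N vN; rewrite gcoef_wcomp !gcoefM //.
case: eqP => [w0|/eqP w0].
  apply: eq_big_ebox => Q le_Q; rewrite !gcoef_wcomp.
  have := eweightD Q (esub N Q); rewrite esubK // w0 => /eqP.
  by rewrite eq_sym addn_eq0 => /andP[-> ->].
symmetry; rewrite big1_seq // => Q; rewrite mem_ebox => /= le_Q.
rewrite !gcoef_wcomp; case: eqP => [wQ|]; last by rewrite mulr0 mul0r.
case: eqP => [wR|]; last by rewrite mulr0.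
by move: w0; rewrite -(esubK le_Q) eweightD wQ wR.
Qed.

Lemma pv_wcomp_derl n a A : pv_wcomp n (gderl (tvar a) A) =
  gderl (tvar a) (pv_wcomp n A).
Proof.
apply: gseriesP => N _;
  rewrite gcoef_derl !gcoef_wcomp gcoef_derl eweightD eweight_tvar addn0.
by case: ifP; rewrite ?mulr0.
Qed.

Lemma pv_wcomp_derr n a A :
  pv_wcomp n (gderr (psivar a) A) = gderr (psivar a) (pv_wcomp n.+1 A).
Proof.
apply: gseriesP => N _;
  rewrite gcoef_derr !gcoef_wcomp gcoef_derr eweightD eweight_psivar.
by rewrite addn1 eqSS; case: ifP; rewrite ?mulr0.
Qed.

(** Exponents below a psi-free exponent are psi-free, and the inclusion keeps the order of the t
    variables, hence the reordering signs. *)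
Lemma OV_PVM f g : OV_PV (f * g) = OV_PV f * OV_PV g.
Proof.
rewrite -(pv_wcomp0_OV_PV f) -(pv_wcomp0_OV_PV g) -pv_wcomp0M.
apply: gseriesP => N vN; rewrite gcoef_OV_PV gcoef_wcomp; case: eqP => // w0.
have vr : evalid td (eres N) by rewrite -evalid_ext eresK.
have vN' : evalid pd (eext (eres N)) by rewrite evalid_ext.
rewrite -[in RHS](eresK w0) !gcoefM //.
transitivity (\sum_(R <- [seq eext i | i <- ebox (eres N)])
    (-1) ^ reorder_exp pd R (esub (eext (eres N)) R) * gcoef (OV_PV f) R
      * gcoef (OV_PV g) (esub (eext (eres N)) R)); last first.
  apply: perm_big; rewrite perm_sym; apply: uniq_perm; first exact: ebox_uniq.
    by rewrite map_inj_uniq ?ebox_uniq // => Q R /(congr1 eres); rewrite !eextK.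
  move=> R; rewrite mem_ebox; apply/eleP/mapP => [le_R|[Q]].
    have wR : eweight R = 0%N.
      by apply/eqP; rewrite sum_nat_eq0; apply/forallP => a;
        have := le_R (psivar a); rewrite eext_psivar leqn0.
    exists (eres R); last by rewrite eresK.
    by rewrite mem_ebox; apply/eleP => a; rewrite !ffunE;
      have := le_R (tvar a); rewrite eext_tvar ffunE.
  rewrite mem_ebox => /eleP le_Q ->; apply: var_case => a;
    last by rewrite eext_psivar.
  by rewrite !eext_tvar.
rewrite [RHS]big_map; apply: eq_big_ebox => Q _.
have -> : esub (eext (eres N)) (eext Q) = eext (esub (eres N) Q).
  apply/ffunP; apply: var_case => a; rewrite ffunE !(eext_tvar, eext_psivar) //.
  by rewrite [RHS]ffunE.
by rewrite re_ext !gcoef_OV_PV !eweight_ext !eextK.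
Qed.

Lemma OV_PV1 : OV_PV (1 : O) = 1.
Proof.
apply: gseriesP => N vN; rewrite gcoef_OV_PV !gcoef_one.
case: (N =P ezero _) => [->|hN].
  rewrite /eweight big1 => [|a _]; rewrite ?ffunE //=.
  by case: eqP => // -[]; apply/ffunP => a; rewrite !ffunE.
case: eqP => // w0; case: eqP => // e; case: hN; rewrite -(eresK w0) e.
by apply/ffunP; apply: var_case => a; rewrite ?eext_tvar ?eext_psivar !ffunE.
Qed.

Lemma gderl_OV_PV a f : gderl (tvar a) (OV_PV f) = OV_PV (gderl a f).
Proof.
apply: gseriesP => N _;
  rewrite gcoef_derl !gcoef_OV_PV gcoef_derl eweightD eweight_tvar addn0.
case: eqP => w0; last by rewrite mulr0.
have -> : N (tvar a) = eres N a by rewrite [RHS]ffunE.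
rewrite -lsg_ext eresK //; congr (_ * _ * gcoef f _).
by apply/ffunP => b; rewrite !ffunE eq_lshift.
Qed.

Lemma gderr_OV_PV a f : gderr (psivar a) (OV_PV f) = 0.
Proof.
apply: gseriesP => N _;
  rewrite gcoef_derr gcoef_OV_PV gcoef0 eweightD eweight_psivar.
by rewrite addn1 mulr0.
Qed.

Lemma ghcomp_OV_PV k f : ghcomp k (OV_PV f) = OV_PV (ghcomp k f).
Proof.
apply: gseriesP => N _; rewrite gcoef_ghcomp !gcoef_OV_PV gcoef_ghcomp.
by case: (eweight N =P 0%N) => [w0|_]; [rewrite -edeg_ext eresK | case: ifP].
Qed.

Lemma ghomog_OV_PV k f : ghomog k (OV_PV f) <-> ghomog k f.
Proof.
split=> /ghomogE h; apply/ghomogE; last by rewrite ghcomp_OV_PV h.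
by apply: OV_PV_inj; rewrite -ghcomp_OV_PV.
Qed.

Lemma ghcomp_wcomp k n A : ghcomp k (pv_wcomp n A) = pv_wcomp n (ghcomp k A).
Proof.
apply: gseriesP => N _; rewrite !(gcoef_ghcomp, gcoef_wcomp).
by case: ifP; case: ifP.
Qed.

End Weights.

(** * The Schouten bracket with a function *)

Section Action.
Variables (K : fieldType) (m : nat) (dV : 'I_m -> int).
Local Notation td := (tdeg dV).
Local Notation pd := (pvdeg dV).
Local Notation O := (gseries K td).
Local Notation P := (gseries K pd).
Implicit Types (f g : O) (A B : P) (v w : seq (int * O)).
Local Notation dpsi a := (gderr (psivar a)).
Local Notation dt a := (gderl (tvar a)).
Local Notation "A \bu B" := (schouten_bullet A B) (at level 40).

Lemma bulletE A B : A \bu B = \sum_(a < m) dpsi a A * dt a B.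
Proof. by []. Qed.

Lemma bullet_is_linearr A : linear (schouten_bullet A).
Proof.
move=> x B B'; rewrite !bulletE scaler_sumr -big_split;
  apply: eq_bigr => a _ /=.
by rewrite linearP mulrDr scalerAr.
Qed.
HB.instance Definition _ A :=
  GRing.isLinear.Build K P P _ (schouten_bullet A) (bullet_is_linearr A).

Lemma bullet_is_linearl B : linear ((fun A => A \bu B) : P -> P).
Proof.
move=> x A A'; rewrite !bulletE scaler_sumr -big_split;
  apply: eq_bigr => a _ /=.
by rewrite linearP mulrDl scalerAl.
Qed.

Definition contract f A : P := A \bu OV_PV f.

Lemma contractE f A : contract f A = \sum_(a < m) dpsi a A * OV_PV (gderl a f).
Proof. by apply: eq_bigr => a _; rewrite gderl_OV_PV. Qed.

Lemma contract_is_linear f : linear (contract f).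
Proof. exact: bullet_is_linearl. Qed.
HB.instance Definition _ f :=
  GRing.isLinear.Build K P P _ (contract f) (contract_is_linear f).

Lemma contractP x f g A : contract (x *: f + g) A =
  x *: contract f A + contract g A.
Proof. by rewrite /contract !linearP. Qed.

Lemma ghomog_psi k a A : ghomog k A -> ghomog (k - (1 - td a)) (dpsi a A).
Proof. by rewrite -pvdeg_psivar; exact: ghomog_derr. Qed.

Lemma ghomog_dt k a A : ghomog k A -> ghomog (k - td a) (dt a A).
Proof. by rewrite -(pvdeg_tvar dV); exact: ghomog_derl. Qed.

Lemma ghomog_iota_der p a f : ghomog p f ->
  ghomog (p - td a) (OV_PV (gderl a f)).
Proof. by move=> hf; apply/ghomog_OV_PV/ghomog_derl. Qed.

Lemma dpsiM q a A B : ghomog q B ->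
  dpsi a (A * B) = A * dpsi a B + (-1) ^ ((1 - td a) * q) *: (dpsi a A * B).
Proof. by move=> hB; rewrite (gderrM _ _ hB) pvdeg_psivar. Qed.

Lemma dtM p a A B : ghomog p A ->
  dt a (A * B) = dt a A * B + (-1) ^ (td a * p) *: (A * dt a B).
Proof. by move=> hA; rewrite (gderlM _ _ hA) pvdeg_tvar. Qed.

Lemma dpsiC a b A : dpsi a (dpsi b A) =
  (-1) ^ ((1 - td a) * (1 - td b)) *: dpsi b (dpsi a A).
Proof. by rewrite gderrC !pvdeg_psivar. Qed.

Lemma dtC a b f : gderl a (gderl b f) =
  (-1) ^ (td a * td b) *: gderl b (gderl a f).
Proof. exact: gderlC. Qed.

Lemma ghcomp_contract k p f A : ghomog p f ->
  ghcomp (k + (p - 1)) (contract f A) = contract f (ghcomp k A).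
Proof.
move=> hf; rewrite !contractE linear_sum; apply: eq_bigr => a _ /=.
rewrite (_ : k + (p - 1) = k - (1 - td a) + (p - td a)); last by ring.
by rewrite (ghcompM _ _ (@ghomog_iota_der _ a _ hf)) -(pvdeg_psivar dV)
  ghcomp_derr.
Qed.

Lemma ghomog_contract k p f A : ghomog p f -> ghomog k A ->
  ghomog (k + (p - 1)) (contract f A).
Proof.
by move=> hf /ghomogE hA; apply/ghomogE; rewrite ghcomp_contract // hA.
Qed.

(** The derivative kills df/dt^a but has to cross it, and then crosses the derivative in psi_a;
    modulo 2 the degree of t^a cancels between these two signs. *)
Lemma dpsi_contract p b f A : ghomog p f ->
  dpsi b (contract f A) =
    (-1) ^ ((1 - td b) * (p - 1)) *: contract f (dpsi b A).
Proof.
move=> hf; rewrite !contractE linear_sum scaler_sumr; apply: eq_bigr => a _ /=.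
rewrite (dpsiM _ _ (@ghomog_iota_der _ a _ hf)) gderr_OV_PV mulr0 add0r dpsiC.
by rewrite -scalerAl scalerA -signzD; congr (_ *: _); sign_eq.
Qed.

Lemma contractC p q f g A : ghomog p f -> ghomog q g ->
  contract g (contract f A) =
    (-1) ^ ((p - 1) * (q - 1)) *: contract f (contract g A).
Proof.
move=> hf hg; rewrite [LHS]contractE [contract f (contract g A)]contractE
  scaler_sumr.
under eq_bigr do rewrite (dpsi_contract _ _ hf) contractE scaler_sumr mulr_suml.
under [RHS]eq_bigr do rewrite (dpsi_contract _ _ hg) contractE scaler_sumr
  mulr_suml scaler_sumr.
rewrite exchange_big /=; apply: eq_bigr => a _; apply: eq_bigr => b _.
rewrite -!scalerAl scalerA (dpsiC b) -!scalerAl scalerA -!mulrA.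
rewrite (gmulC (@ghomog_iota_der _ b _ hg) (@ghomog_iota_der _ a _ hf))
  -!scalerAr scalerA.
by rewrite -!signzD; congr (_ *: _); sign_eq.
Qed.

Lemma contractM p q f A B : ghomog p f -> ghomog q B ->
  contract f (A * B) =
    A * contract f B + (-1) ^ ((p - 1) * q) *: (contract f A * B).
Proof.
move=> hf hB; rewrite !contractE mulr_sumr mulr_suml scaler_sumr -big_split.
apply: eq_bigr => a _ /=.
rewrite (dpsiM _ _ hB) mulrDl -!mulrA -scalerAl -mulrA; congr (_ + _).
rewrite (gmulC hB (@ghomog_iota_der _ a _ hf)) -scalerAr scalerA -signzD.
by congr (_ *: _); sign_eq.
Qed.

Lemma contract_OV f g : contract f (OV_PV g) = 0.
Proof. by rewrite contractE big1 // => a _; rewrite gderr_OV_PV mul0r. Qed.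

Lemma contract_mulr p q f A g : ghomog p f -> ghomog q g ->
  contract f (A * OV_PV g) = (-1) ^ ((p - 1) * q) *: (contract f A * OV_PV g).
Proof.
by move=> hf /ghomog_OV_PV hg;
  rewrite (contractM _ hf hg) contract_OV mulr0 add0r.
Qed.

Lemma contract_mull p k f A g : ghomog p f -> ghomog k A ->
  contract f (OV_PV g * A) = OV_PV g * contract f A.
Proof.
by move=> hf hA; rewrite (contractM _ hf hA) contract_OV mul0r scaler0 addr0.
Qed.

(** The Hessian terms, which arise when d/dt^a in A . [contract f B] falls on df/dt^b. *)
Definition second_order k A B f : P := \sum_(a < m) \sum_(b < m)
  (-1) ^ (td a * (k - 1 + td b)) *:
    (dpsi a A * dpsi b B * OV_PV (gderl a (gderl b f))).

Lemma dt_contract k a f B : ghomog k B ->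
  dt a (contract f B) = contract f (dt a B) + \sum_(b < m)
    (-1) ^ (td a * (k - 1 + td b)) *: (dpsi b B * OV_PV (gderl a (gderl b f))).
Proof.
move=> hB; rewrite !contractE linear_sum -big_split; apply: eq_bigr => b _ /=.
rewrite (dtM _ _ (@ghomog_psi _ b _ hB)) gderl_OV_PV gderlrC;
  congr (_ + _ *: _).
by sign_eq.
Qed.

Lemma contract_bullet k p f A B : ghomog k B -> ghomog p f ->
  contract f (A \bu B) = A \bu contract f B - second_order k A B f
    + (-1) ^ ((p - 1) * (k - 1)) *: (contract f A \bu B).
Proof.
move=> hB hf; rewrite !bulletE linear_sum /second_order scaler_sumr -sumrB
  -big_split.
apply: eq_bigr => a _ /=.
rewrite (contractM _ hf (@ghomog_dt _ a _ hB)) (dt_contract _ _ hB).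
have -> : \sum_(b < m) (-1) ^ (td a * (k - 1 + td b)) *:
      (dpsi a A * dpsi b B * OV_PV (gderl a (gderl b f))) =
    dpsi a A * \sum_(b < m) (-1) ^ (td a * (k - 1 + td b)) *:
      (dpsi b B * OV_PV (gderl a (gderl b f))).
  by rewrite mulr_sumr; apply: eq_bigr => b _; rewrite -scalerAr mulrA.
rewrite -mulrBr addrK; congr (_ + _);
  rewrite (dpsi_contract _ _ hf) -scalerAl scalerA -signzD.
by congr (_ *: _); sign_eq.
Qed.

Lemma second_orderC j k A B f : ghomog j A -> ghomog k B ->
  second_order k A B f = (-1) ^ ((j - 1) * (k - 1)) *: second_order j B A f.
Proof.
move=> hA hB; rewrite /second_order exchange_big scaler_sumr;
  apply: eq_bigr => b _ /=.
rewrite scaler_sumr; apply: eq_bigr => a _ /=.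
rewrite (gmulC (@ghomog_psi _ a _ hA) (@ghomog_psi _ b _ hB)) dtC linearZ /=
  -scalerAl -scalerAr.
by rewrite !scalerA -!signzD; congr (_ *: _); sign_eq.
Qed.

Lemma contract_schouten j k p f A B : ghomog j A -> ghomog k B -> ghomog p f ->
  contract f (schouten j k A B) = schouten j (k + (p - 1)) A (contract f B)
   + (-1) ^ ((p - 1) * (k - 1)) *: schouten (j + (p - 1)) k (contract f A) B.
Proof.
move=> hA hB hf; rewrite /schouten linearD linearZ /=.
rewrite (contract_bullet _ hB hf) (contract_bullet _ hA hf)
  (second_orderC _ hA hB).
rewrite !(scalerDr, scalerN, scalerA) -!signzD.
have -> : (-1) ^ (j * k + j + k + (p - 1) * (j - 1)) =
  (-1) ^ (j * (k + (p - 1)) + j + (k + (p - 1))) :> K by sign_eq.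
have -> : (-1) ^ ((p - 1) * (k - 1) + ((j + (p - 1)) * k + (j + (p - 1)) + k)) =
  (-1) ^ (j * k + j + k) :> K by sign_eq.
(* The symmetry sign of the second-order terms is opposite to the sign of the Schouten bracket; this
   is what makes them cancel. *)
have -> : (-1) ^ ((j - 1) * (k - 1)) = - (-1) ^ (j * k + j + k) :> K.
  rewrite -[RHS]mulN1r -[-1 in RHS]expr1z -signzD; sign_eq.
rewrite scaleNr opprK; set x := A \bu _; set y := _ *: second_order _ _ _ _.
set z := _ *: (contract f A \bu B); set t := _ *: (B \bu _);
  set u := _ *: (_ \bu A).
by rewrite [LHS](AC (3*3) (1*6*(3*4)*(2*5))) /= subrr addr0.
Qed.

End Action.

(** * Signed permutations and unshuffles *)

Section Insertion.
Variable n : nat.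

(** As [permute v s] reads v at s i, this permutation puts the head of a list at position i and
    permutes the tail by t, which fits induction on lists. *)
Definition inserted (p : 'I_n.+1 * 'S_n) : 'S_n.+1 := lift_perm p.1 ord0 p.2.

Lemma inserted_bij : bijective inserted.
Proof.
apply: inj_card_bij => [[i s] [j t]|]; last first.
  by rewrite card_prod card_ord !card_Sn.
rewrite /inserted /= => e.
have ij : i = j.
  by apply: (@perm_inj _ (lift_perm i ord0 s)); rewrite {2}e !lift_perm_id.
rewrite -ij in e *; congr (_, _); apply/permP => k.
by apply: (@lift_inj _ ord0); rewrite -!(lift_perm_lift i) e.
Qed.

Lemma insertedP (s : 'S_n.+1) : exists i t, s = lift_perm i ord0 t.
Proof. by have [g _ /(_ s) <-] := inserted_bij; exists (g s).1, (g s).2. Qed.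

Lemma big_inserted (V : nmodType) (p : pred 'S_n.+1) (F : 'S_n.+1 -> V) :
  \sum_(s | p s) F s =
  \sum_(i < n.+1) \sum_(t : 'S_n | p (lift_perm i ord0 t)) F
    (lift_perm i ord0 t).
Proof.
rewrite (reindex inserted) /=; last exact/onW_bij/inserted_bij.
by rewrite pair_big_dep; apply: eq_bigl => -[].
Qed.

End Insertion.

Section InversionExponent.

(** With products of degrees as weight this is [koszul_exp], with weight 1 the number of inversions;
    a general weight handles the Koszul sign and the signature as one. *)
Definition inv_exp n (b : 'I_n -> 'I_n -> int) (s : 'S_n) : int :=
  \sum_(i < n) \sum_(j < n | (i < j)%N && (s j < s i)%N) b (s i) (s j).

Lemma inv_exp_lift n (b : 'I_n.+1 -> 'I_n.+1 -> int) i0 (s : 'S_n) :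
  inv_exp b (lift_perm i0 ord0 s) =
  \sum_(k < n | (k < i0)%N) b (lift ord0 (s k)) ord0
    + inv_exp (fun i j => b (lift ord0 i) (lift ord0 j)) s.
Proof.
rewrite /inv_exp (bigD1_ord i0) //= [X in X + _]big1 ?add0r => [|j]; last first.
  by rewrite lift_perm_id andbF.
rewrite [X in X + _]big_mkcond -big_split; apply: eq_bigr => k _ /=.
rewrite big_mkcond (bigD1_ord i0) //= lift_perm_id lift_perm_lift;
  congr (_ + _).
  rewrite andbT; congr (if _ then _ else _).
  by rewrite /bump; case: (leqP i0 k); lia.
rewrite [RHS]big_mkcond; apply: eq_bigr => l _ /=; rewrite lift_perm_lift.
by rewrite /= !/(bump 0 _) /= !add1n ltnS ltnNge leq_bump2 -ltnNge.
Qed.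

Lemma odd_perm_inv_exp n (s : 'S_n) : odd_perm s =
  oddz (inv_exp (fun _ _ => 1) s).
Proof.
elim: n s => [|n IHn] s.
  by rewrite /inv_exp big_ord0; have -> : s = 1%g by [apply/permP; case];
    rewrite odd_perm1.
have [i [t ->]] := insertedP s.
rewrite odd_lift_perm IHn inv_exp_lift oddzD addbF; congr (_ (+) _).
have le_in : (i <= n)%N by rewrite -ltnS.
by rewrite -(big_ord_widen n (fun=> 1 : int)) // sumr_const card_ord pmulrn
  intz.
Qed.

Lemma inv_expD n (b b' : 'I_n -> 'I_n -> int) s :
  inv_exp b s + inv_exp b' s = inv_exp (fun i j => b i j + b' i j) s.
Proof.
by rewrite /inv_exp -big_split; apply: eq_bigr => i _; rewrite -big_split.
Qed.

Lemma koszul_sign (K : fieldType) n (k : 'I_n -> int) (s : 'S_n) :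
  (-1) ^ koszul_exp k s * (-1) ^+ s =
    (-1) ^ inv_exp (fun i j => k i * k j + 1) s :> K.
Proof. by rewrite -inv_expD signzD odd_perm_inv_exp -signz_odd. Qed.

End InversionExponent.

Section PermuteTuple.
Variables (T : eqType) (n : nat).

Lemma permute_insert (x : T) (v : n.-tuple T) (i : 'I_n.+1) (s : 'S_n) :
  let w : seq T := permute v s in
  permute [tuple of x :: v] (lift_perm i ord0 s) =
    take i w ++ x :: drop i w :> seq T.
Proof.
move=> w; have szw : size w = n by rewrite size_tuple.
have le_in : (i <= n)%N by rewrite -ltnS.
apply: (@eq_from_nth _ x) => [|k].
  by rewrite size_tuple size_cat /= size_takel ?size_drop ?szw //; lia.
rewrite size_tuple => lt_k.
have -> : nth x (permute [tuple of x :: v] (lift_perm i ord0 s)) k =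
    tnth [tuple of x :: v] (lift_perm i ord0 s (Ordinal lt_k)).
  by rewrite -[k]/(val (Ordinal lt_k)) -tnth_nth tnth_mktuple.
have wE l (lt_l : (l < n)%N) : nth x w l = tnth v (s (Ordinal lt_l)).
  by rewrite -[l]/(val (Ordinal lt_l)) /w -tnth_nth tnth_mktuple.
rewrite nth_cat size_takel ?szw //.
case: (unliftP i (Ordinal lt_k)) => [l|] e.
  rewrite e lift_perm_lift tnthS.
  have {}e : k = bump i l by have := congr1 val e.
  have lt_l : (l < n)%N by [].
  have -> : tnth v (s l) = nth x w l.
    by rewrite (wE _ lt_l); congr (tnth v (s _)); apply: val_inj.
  rewrite e /bump; case: (leqP i l) => h /=.
    rewrite ltnNge add1n leqW //= subSn //= nth_drop subnKC //.
  by rewrite add0n h nth_take.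
have {}e : k = i by have := congr1 val e.
rewrite (_ : Ordinal lt_k = i); last exact: val_inj.
by rewrite lift_perm_id e ltnn subnn.
Qed.

End PermuteTuple.

Section SignedPermutation.
Variables (T : eqType) (K : fieldType) (V : lmodType K) (b : T -> T -> int).
Variables (D : T -> Prop).

Definition all_in (v : seq T) := forall x, x \in v -> D x.

Lemma all_in_cat u v : all_in (u ++ v) <-> all_in u /\ all_in v.
Proof.
split=> [h|[hu hv] x]; last by rewrite mem_cat => /orP[/hu|/hv].
by split=> x xu; apply: h; rewrite mem_cat xu ?orbT.
Qed.

Lemma all_in_cons x v : all_in (x :: v) <-> D x /\ all_in v.
Proof.
split=> [h|[hx hv] y]; last by rewrite inE => /predU1P[->|/hv].
by split=> [|y yv]; apply: h; rewrite inE ?eqxx ?yv ?orbT.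
Qed.

Definition swap_sign (Phi : seq T -> V) := forall u x y t,
  all_in (u ++ x :: y :: t) ->
  Phi (u ++ x :: y :: t) = (-1) ^ b x y *: Phi (u ++ y :: x :: t).

Lemma swap_sign_front Phi u x t : swap_sign Phi -> all_in (u ++ x :: t) ->
  Phi (u ++ x :: t) = (-1) ^ (\sum_(y <- u) b y x) *: Phi (x :: u ++ t).
Proof.
move=> swp; elim: u => [|y u IHu] in t Phi swp *;
  first by rewrite big_nil scale1r.
rewrite cat_cons all_in_cons => -[Dy Dux].
have := IHu t (fun w => Phi (y :: w)) _ Dux; rewrite /= => ->; last first.
  by move=> u' x' y' t' D'; apply: (swp (y :: u')); apply/all_in_cons.
rewrite (swp [::] y x); last first.
  apply/all_in_cons; split=> //; move: Dux;
    rewrite all_in_cat all_in_cons => -[Du [Dx Dt]].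
  by apply/all_in_cons; split=> //; apply/all_in_cat.
by rewrite scalerA -signzD big_cons addrC.
Qed.

(** The head of v stands at some position i of the permuted word. Moving it to the front costs b for
    every letter crossed, and induction applies to the tail with the head fixed. *)
Lemma swap_sign_permute Phi n (v : n.-tuple T) (s : 'S_n) :
  swap_sign Phi -> all_in v ->
  Phi (permute v s) = (-1) ^ inv_exp (fun i j => b (tnth v i) (tnth v j)) s
    *: Phi v.
Proof.
elim: n v s Phi => [|n IHn] v s Phi swp Dv.
  rewrite /inv_exp big_ord0 scale1r; congr Phi.
  by rewrite (tuple0 v) (tuple0 (permute _ _)).
have [i [t ->]] := insertedP s; case/tupleP: v Dv => x v Dv.
have [Dx Dv'] := (all_in_cons _ _).1 Dv.
rewrite permute_insert inv_exp_lift.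
set w := permute v t.
have Dw : all_in w by move=> y /mapP[k _ ->]; apply: Dv'; exact: mem_tnth.
have {}swp' : swap_sign (fun u => Phi (x :: u)).
  by move=> u' x' y' t' D'; apply: (swp (x :: u')); apply/all_in_cons.
rewrite (swap_sign_front swp); last first.
  apply/all_in_cat; rewrite all_in_cons.
  by split; [|split=> //] => y; [move/mem_take|move/mem_drop]; apply: Dw.
rewrite cat_take_drop (IHn v t (fun u => Phi (x :: u))) // scalerA -signzD.
congr ((-1) ^ (_ + _) *: _); last first.
  by apply: eq_bigr => k _; apply: eq_bigr => l _; rewrite !tnthS.
have le_in : (i <= n)%N by rewrite -ltnS.
rewrite (big_nth x) size_takel ?size_tuple // big_mkord
  (big_ord_widen n (fun k => b (nth x (take i w) k) x)) //.
apply: eq_bigr => k lt_k; rewrite nth_take // tnthS.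
by rewrite -tnth_nth tnth_mktuple.
Qed.

End SignedPermutation.

Lemma unshuffleP n s (t : 'S_n) :
  reflect (forall i j : 'I_n, (i < j)%N -> (j < s)%N || (s <= i)%N ->
    (t i < t j)%N)
    (unshuffle s t).
Proof.
apply: (iffP forallP) => h i; first by move=> j ij c;
  apply: (implyP (forallP (h i) j)); rewrite ij.
by apply/forallP => j; apply/implyP => /andP[ij c]; apply: h.
Qed.

(** The least letter must open one of the two increasing blocks: it sits at position 0 if the first
    block is nonempty, or at position s. *)
Lemma unshuffle_lift n s (i0 : 'I_n.+1) (t : 'S_n) : (s <= n.+1)%N ->
  unshuffle s (lift_perm i0 ord0 t) =
  ((i0 == 0 :> nat) && (0 < s)%N && unshuffle s.-1 t)
  || ((i0 == s :> nat) && unshuffle s t).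
Proof.
move=> le_s; apply/unshuffleP/orP.
  move=> h.
  have ht (s' : nat) : (forall k l : 'I_n, (k < l)%N ->
    (l < s')%N || (s' <= k)%N ->
      (lift i0 l < s)%N || (s <= lift i0 k)%N) -> unshuffle s' t.
    move=> hs; apply/unshuffleP => k l kl c.
    have /h : (lift i0 k < lift i0 l)%N by rewrite /= ltnNge leq_bump2 -ltnNge.
    by move/(_ (hs _ _ kl c));
      rewrite !lift_perm_lift /= ltnNge leq_bump2 -ltnNge.
  have h0 k : (k < i0)%N -> ~ ((i0 < s)%N || (s <= k)%N).
    move=> ki0 c; have ltk : (k < n.+1)%N := ltn_trans ki0 (ltn_ord i0).
    by have := h (Ordinal ltk) i0 ki0 c; rewrite lift_perm_id.
  have [i00|i0_gt0] := posnP (i0 : nat).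
    case: s => [|s] in le_s h ht h0 *; [right | left].
      by rewrite i00 /=; apply: ht => k l _ _; rewrite orbT.
    by rewrite /=; apply: ht => k l kl c; rewrite /= i00 /bump /= !add1n ltnS.
  right; have ei : i0 = s :> nat.
    have := h0 0%N i0_gt0; have := h0 s; lia.
  rewrite ei eqxx; apply: ht => k l kl c; rewrite /= ei /bump.
  by case: (leqP s l); case: (leqP s k) c; lia.
move=> h i j ij c.
have hi0 : i0 = 0%N :> nat /\ (0 < s)%N \/ i0 = s :> nat.
  by case: h => [/andP[/andP[/eqP -> ->]]|/andP[/eqP ->]]; [left | right].
case: (unliftP i0 j) ij c => [l|] ->; case: (unliftP i0 i) => [k|] ->;
  rewrite ?ltnn //.
- rewrite !lift_perm_lift /= /bump => kl c.
  rewrite /bump !add1n ltnS; case: h => /andP[].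
    move=> /andP[/eqP e s_gt0] /unshuffleP; apply; move: kl c; rewrite e /=;
      lia.
  move=> /eqP e /unshuffleP; apply; move: kl c; rewrite e; case: leqP;
    case: leqP; lia.
- by rewrite lift_perm_id lift_perm_lift.
- by rewrite /= /bump; lia.
Qed.

Section Shuffles.
Variables (T : eqType) (K : fieldType) (V : lmodType K).
Implicit Types (b : T -> T -> int) (v : seq T) (G : seq T -> seq T -> V).

(* The sum of [G s t] over all ways to distribute the letters of [v], in order,
   over two words [s] and [t]; moving [x] from the head of [v] to that of [t]
   makes it pass the letters of [s]. *)
Fixpoint shuffle_sum b v G : V :=
  if v is x :: v' then
    shuffle_sum b v' (fun s t => G (x :: s) t)
    + shuffle_sum b v' (fun s t => (-1) ^ (\sum_(y <- s) b y x) *: G s (x :: t))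
  else G [::] [::].

Lemma eq_shuffle_sum b v G G'
  : (forall s t, perm_eq (s ++ t) v -> G s t = G' s t) ->
  shuffle_sum b v G = shuffle_sum b v G'.
Proof.
elim: v => [|x v IHv] /= in G G' *; first by apply.
move=> h; congr (_ + _); apply: IHv => s t st; first by apply: h;
  rewrite /= perm_cons.
by rewrite h // -cat1s perm_catCA /= perm_cons.
Qed.

Lemma shuffle_sumD b v G G' :
  shuffle_sum b v (fun s t => G s t + G' s t) =
    shuffle_sum b v G + shuffle_sum b v G'.
Proof.
elim: v => [//|x v IHv] /= in G G' *; rewrite IHv addrACA -[X in _ = _ + X]IHv.
by congr (_ + _); apply: eq_shuffle_sum => s t _; rewrite scalerDr.
Qed.

Lemma shuffle_sumZ a b v G : shuffle_sum b v (fun s t => a *: G s t) =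
  a *: shuffle_sum b v G.
Proof.
elim: v => [//|x v IHv] /= in G *; rewrite IHv scalerDr -[X in _ = _ + X]IHv.
by congr (_ + _); apply: eq_shuffle_sum => s t _; rewrite !scalerA mulrC.
Qed.

Definition cross b (s t : seq T) : int := \sum_(x <- s) \sum_(y <- t) b x y.

(** Serves to compare the two halves A . B and B . A of the Schouten bracket, in which the two words
    are interchanged. *)
Lemma shuffle_sumC b v G : (forall x y, b x y = b y x) ->
  shuffle_sum b v G = shuffle_sum b v (fun s t => (-1) ^ cross b s t *: G t s).
Proof.
move=> bC; elim: v => [|x v IHv] /= in G *;
  first by rewrite /cross big_nil scale1r.
rewrite addrC (IHv (fun s t => G (x :: s) t)) IHv.
congr (_ + _); apply: eq_shuffle_sum => s t _.
  by rewrite scalerA -signzD /cross big_cons addrC;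
    congr ((-1) ^ (_ + _) *: _); apply: eq_bigr => y _.
have -> : cross b s (x :: t) = \sum_(y <- s) b y x + cross b s t.
  by rewrite /cross -big_split; apply: eq_bigr => y _; rewrite big_cons.
by rewrite scalerA -signzD; congr (_ *: _); sign_eq.
Qed.

(** By [unshuffle_lift] the head of v opens the first or the second word, which are the two summands
    of the recursion. Block lengths 0 and n are included. *)
Lemma shuffle_sum_unshuffle b n (v : n.-tuple T) G :
  \sum_(s < n.+1) \sum_(t : 'S_n | unshuffle s t)
    (-1) ^ inv_exp (fun i j => b (tnth v i) (tnth v j)) t *:
      G (take s (permute v t)) (drop s (permute v t)) = shuffle_sum b v G.
Proof.
elim: n v G => [|n IHn] v G.
  rewrite (tuple0 v) /= big_ord1 (bigD1 1%g) /=; last by apply/unshuffleP; case.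
  rewrite big1 => [|t /andP[_ /eqP[]]]; last by apply/permP; case.
  by rewrite addr0 /inv_exp big_ord0 scale1r take0 drop0; congr G;
    apply: size0nil; rewrite size_map size_enum_ord.
case/tupleP: v => x v; rewrite /= -!IHn.
pose w (t : 'S_n) : seq T := permute v t.
pose E (t : 'S_n) := inv_exp (fun i j => b (tnth v i) (tnth v j)) t.
have EE (i : 'I_n.+1) (t : 'S_n) : inv_exp
  (fun k l => b (tnth [tuple of x :: v] k) (tnth [tuple of x :: v] l))
      (lift_perm i ord0 t) = \sum_(y <- take i (w t)) b y x + E t.
  rewrite inv_exp_lift; congr (_ + _); last first.
    by apply: eq_bigr => k _; apply: eq_bigr => l _; rewrite !tnthS.
  have le_in : (i <= n)%N by rewrite -ltnS.
  rewrite (big_nth x) size_takel ?size_tuple // big_mkord.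
  rewrite (big_ord_widen n (fun k => b (nth x (take i (w t)) k) x)) //.
  apply: eq_bigr => k lt_k; rewrite nth_take // tnthS.
  by rewrite -tnth_nth tnth_mktuple.
pose F s (i : 'I_n.+1) (t : 'S_n) :=
  (-1) ^ (\sum_(y <- take i (w t)) b y x + E t) *:
  G (take s (take i (w t) ++ x :: drop i (w t)))
    (drop s (take i (w t) ++ x :: drop i (w t))).
transitivity (\sum_(s < n.+2) \sum_(i < n.+1) \sum_(t : 'S_n)
   ((if (i == 0 :> nat) && (0 < s)%N && unshuffle s.-1 t then F s i t else 0)
    + (if (i == s :> nat) && unshuffle s t then F s i t else 0))).
  apply: eq_bigr => s _; rewrite big_inserted; apply: eq_bigr => i _.
  rewrite big_mkcond; apply: eq_bigr => t _.
  rewrite unshuffle_lift -1?ltnS // EE permute_insert -/(w t) -/(F s i t).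
  case: eqP => [i0|_] /=; last by rewrite add0r.
  have [s0|s_gt0] := posnP (s : nat); first by rewrite s0 /= add0r.
  have -> : (i == s :> nat) = false by apply/eqP; lia.
  by rewrite orbF addr0.
under eq_bigr => s _ do under eq_bigr => i _ do rewrite big_split.
under eq_bigr => s _ do rewrite big_split.
rewrite big_split /=; congr (_ + _).
  rewrite big_ord_recl /= [X in X + _]big1 ?add0r => [|i _];
    last by rewrite big1 // => t _; rewrite andbF.
  apply: eq_bigr => s _;
    rewrite big_ord_recl /= [X in _ + X]big1 ?addr0 => [|i _]; last first.
    by rewrite big1.
  rewrite [RHS]big_mkcond; apply: eq_bigr => t _; case: ifP => // _.
  by rewrite /F /= take0 drop0 big_nil add0r.
(* Here the head opens the second word, so s equals its position i and the sum over s has a single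
   nonzero term. *)
rewrite exchange_big /=; apply: eq_bigr => i _.
rewrite (bigD1 (widen_ord (leqnSn _) i)) //= [X in _ + X]big1 ?addr0 => [|s];
  last first.
  move=> /eqP si; rewrite big1 // => t _; case: eqP => // e; case: si;
    exact: val_inj.
rewrite [RHS]big_mkcond; apply: eq_bigr => t _; rewrite eqxx /=.
case: (unshuffle i t) => //.
have szi : size (take i (w t)) = i by rewrite size_takel // size_tuple -ltnS.
by rewrite /F take_size_cat // drop_size_cat // scalerA -signzD [E t + _]addrC.
Qed.

End Shuffles.

(** * Iterated contractions *)

Section IteratedAction.
Variables (K : fieldType) (m : nat) (dV : 'I_m -> int).
Local Notation td := (tdeg dV).
Local Notation pd := (pvdeg dV).
Local Notation O := (gseries K td).
Local Notation P := (gseries K pd).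
Local Notation arg := (int * O)%type.
Local Notation hargs := (homog_args (@ghomog K m td)).
Implicit Types (f g : O) (A B : P) (v : seq arg).
Local Notation dpsi a := (gderr (psivar a)).
Local Notation dt a := (gderl (tvar a)).
Local Notation "A \bu B" := (schouten_bullet A B) (at level 40).

(* The restriction to psi = 0. *)
Definition PV_OV A : O := fun M => gcoef A (eext M).

Lemma gcoef_PV_OV A N : gcoef (PV_OV A) N = gcoef A (eext N).
Proof.
rewrite /PV_OV (gcoef_fun td (fun N => gcoef A (eext N))).
by case: ifP => // /negbT; rewrite -(evalid_ext dV) => /gcoef_invalid ->.
Qed.

Lemma PV_OVK A : OV_PV (PV_OV A) = pv_wcomp 0 A.
Proof.
apply: gseriesP => N _; rewrite gcoef_OV_PV gcoef_wcomp.
by case: eqP => // w0; rewrite gcoef_PV_OV eresK.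
Qed.

Lemma OV_PVK f : PV_OV (OV_PV f) = f.
Proof. by apply: OV_PV_inj; rewrite PV_OVK pv_wcomp0_OV_PV. Qed.

Lemma PV_OV_is_linear : linear PV_OV.
Proof.
by move=> a A B; apply: OV_PV_inj; rewrite linearP /= !PV_OVK linearP.
Qed.
HB.instance Definition _ := GRing.isLinear.Build K P O _ PV_OV PV_OV_is_linear.

Lemma PV_OVM A B : PV_OV (A * B) = PV_OV A * PV_OV B.
Proof. by apply: OV_PV_inj; rewrite OV_PVM !PV_OVK pv_wcomp0M. Qed.

Lemma ghcomp_PV_OV k A : ghcomp k (PV_OV A) = PV_OV (ghcomp k A).
Proof. by apply: OV_PV_inj; rewrite -ghcomp_OV_PV !PV_OVK ghcomp_wcomp. Qed.

Lemma ghomog_PV_OV k A : ghomog k A -> ghomog k (PV_OV A).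
Proof. by move=> /ghomogE h; apply/ghomogE; rewrite ghcomp_PV_OV h. Qed.

(** Setting psi = 0 commutes with d/dt^a, so B enters only through its restriction: this is the
    source of the nested brackets. *)
Lemma PV_OV_bullet A B : PV_OV (A \bu B) = PV_OV (contract (PV_OV B) A).
Proof.
rewrite bulletE contractE !linear_sum; apply: eq_bigr => a _ /=.
rewrite !PV_OVM OV_PVK; congr (_ * _); apply: OV_PV_inj.
by rewrite PV_OVK pv_wcomp_derl -gderl_OV_PV PV_OVK.
Qed.

Fixpoint contracts v A : P :=
  if v is x :: v' then contracts v' (contract x.2 A) else A.

Definition shifted_deg v : int := \sum_(x <- v) (x.1 - 1).

Lemma shifted_deg_cons x v : shifted_deg (x :: v) = x.1 - 1 + shifted_deg v.
Proof. by rewrite /shifted_deg big_cons. Qed.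

Lemma shifted_degE v : shifted_deg v = totdeg v - (size v)%:Z.
Proof.
rewrite /totdeg; elim: v => [|x v IHv]; first by rewrite /shifted_deg !big_nil.
by rewrite shifted_deg_cons IHv big_cons /= -[in RHS]addn1 PoszD; ring.
Qed.

Lemma hargs_cons x v : hargs (x :: v) <-> ghomog x.1 x.2 /\ hargs v.
Proof. exact: (all_in_cons (fun x : arg => ghomog x.1 x.2)). Qed.

Lemma hargs_cat u v : hargs (u ++ v) <-> hargs u /\ hargs v.
Proof. exact: (all_in_cat (fun x : arg => ghomog x.1 x.2)). Qed.

Lemma hargs_perm u v : perm_eq u v -> hargs v -> hargs u.
Proof. by move=> /perm_mem uv hv x xu; apply: hv; rewrite -uv. Qed.

Lemma contracts_is_linear v : linear (contracts v).
Proof. by elim: v => [|x v IHv] // a A B /=; rewrite linearP IHv. Qed.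
HB.instance Definition _ v :=
  GRing.isLinear.Build K P P _ (contracts v) (contracts_is_linear v).

Lemma contracts_cat u v A : contracts (u ++ v) A = contracts v (contracts u A).
Proof. by elim: u A => [|x u IHu] A //=. Qed.

Lemma ghcomp_contracts k v A : hargs v ->
  ghcomp (k + shifted_deg v) (contracts v A) = contracts v (ghcomp k A).
Proof.
elim: v k A => [|x v IHv] k A; first by rewrite /shifted_deg big_nil addr0.
rewrite hargs_cons => -[hx hv]; rewrite shifted_deg_cons addrA /= IHv //.
by rewrite ghcomp_contract.
Qed.

Lemma ghomog_contracts k v A : hargs v -> ghomog k A ->
  ghomog (k + shifted_deg v) (contracts v A).
Proof.
by move=> hv /ghomogE hA; apply/ghomogE; rewrite ghcomp_contracts // hA.
Qed.

Lemma contract_contracts p f v A : hargs v -> ghomog p f ->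
  contract f (contracts v A) =
    (-1) ^ ((p - 1) * shifted_deg v) *: contracts v (contract f A).
Proof.
move=> hv hf; elim: v A hv => [|x v IHv] A.
  by rewrite /shifted_deg big_nil mulr0 scale1r.
rewrite hargs_cons => -[hx hv] /=;
  rewrite IHv // (contractC _ hx hf) linearZ /= scalerA.
by rewrite -signzD shifted_deg_cons; congr (_ *: _); sign_eq.
Qed.

Lemma contracts_mulr q v A g : hargs v -> ghomog q g ->
  contracts v (A * OV_PV g) =
    (-1) ^ (q * shifted_deg v) *: (contracts v A * OV_PV g).
Proof.
move=> + hg; elim: v A => [|x v IHv] A.
  by rewrite /shifted_deg big_nil mulr0 scale1r.
rewrite hargs_cons => -[hx hv] /=;
  rewrite (contract_mulr _ hx hg) linearZ /= IHv // scalerA.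
by rewrite -signzD shifted_deg_cons; congr (_ *: _); sign_eq.
Qed.

Lemma contracts_mull k v A g : hargs v -> ghomog k A ->
  contracts v (OV_PV g * A) = OV_PV g * contracts v A.
Proof.
elim: v k A => [|x v IHv] k A // /hargs_cons [hx hv] hA /=.
by rewrite (contract_mull _ hx hA) (IHv (k + (x.1 - 1))) //;
  exact: ghomog_contract.
Qed.

Definition shifted_form (x y : arg) : int := (x.1 - 1) * (y.1 - 1).

Lemma sum_shifted_form s x : \sum_(y <- s) shifted_form y x =
  (x.1 - 1) * shifted_deg s.
Proof.
by rewrite /shifted_deg mulr_sumr; apply: eq_bigr => y _;
  rewrite /shifted_form mulrC.
Qed.

Lemma cross_shifted_form s t : cross shifted_form s t =
  shifted_deg s * shifted_deg t.
Proof.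
rewrite /cross {1}/shifted_deg mulr_suml; apply: eq_bigr => x _.
by rewrite /shifted_deg mulr_sumr.
Qed.

(** Iterates [contract_schouten]. The arguments that land on A have to cross B, whence the explicit
    sign; the signs of separating s from t are those of [shuffle_sum]. *)
Lemma contracts_schouten j k v A B : hargs v -> ghomog j A -> ghomog k B ->
  contracts v (schouten j k A B) =
    shuffle_sum shifted_form v (fun s t => (-1) ^ ((k - 1) * shifted_deg s) *:
    schouten (j + shifted_deg s) (k + shifted_deg t) (contracts s A)
      (contracts t B)).
Proof.
elim: v j k A B => [|x v IHv] j k A B.
  by rewrite /shifted_deg /= big_nil mulr0 scale1r !addr0.
rewrite hargs_cons => -[hx hv] hA hB /=;
  rewrite (contract_schouten hA hB hx) linearD linearZ /=.
rewrite !IHv //; try exact: ghomog_contract.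
rewrite addrC -shuffle_sumZ; congr (_ + _); apply: eq_shuffle_sum => s t _;
  rewrite scalerA -signzD.
  by rewrite shifted_deg_cons !addrA; congr (_ *: _); sign_eq.
by rewrite sum_shifted_form shifted_deg_cons !addrA; congr (_ *: _); sign_eq.
Qed.

Definition derived_bracket A v : O := PV_OV (contracts v A).

Lemma ghomog_derived_bracket k A v : ghomog k A -> hargs v ->
  ghomog (k + shifted_deg v) (derived_bracket A v).
Proof. by move=> hA hv; apply/ghomog_PV_OV/ghomog_contracts. Qed.

(** Exchanging s and t turns one half of the Schouten bracket into the other, hence the factor 2.
    The contraction with the inner bracket comes last in [F]; [contract_contracts] moves it to the
    front, and its sign cancels the one in [F]. *)
Lemma derived_bracket_schouten A v : ghomog 2 A -> hargs v ->
  derived_bracket (schouten 2 2 A A) v =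
    2%:R *: shuffle_sum shifted_form v
      (fun s t => derived_bracket A
      ((2 + shifted_deg s, derived_bracket A s) :: t)).
Proof.
move=> hA hv; rewrite /derived_bracket contracts_schouten //.
have PV_OV_shuffle_sum G : PV_OV (shuffle_sum shifted_form v G) =
  shuffle_sum shifted_form v (fun s t => PV_OV (G s t)).
  elim: (v) G => [//|x w IHw] G /=; rewrite linearD /= !IHw; congr (_ + _).
  by apply: eq_shuffle_sum => s t _; rewrite linearZ.
rewrite PV_OV_shuffle_sum.
pose F s t := (-1) ^ (shifted_deg s * shifted_deg t + shifted_deg t) *: PV_OV
  (contracts t A \bu contracts s A).
transitivity (shuffle_sum shifted_form v (fun s t =>
    (-1) ^ shifted_deg s *: PV_OV (contracts s A \bu contracts t A) + F s t)).
  apply: eq_shuffle_sum => s t _;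
    rewrite /schouten linearZ linearD linearZ /= scalerDr scalerA -signzD.
  by congr (_ *: _ + _ *: _); sign_eq.
rewrite shuffle_sumD shuffle_sumC; last by move=> x y;
  rewrite /shifted_form mulrC.
rewrite (_ : shuffle_sum _ _ _ = shuffle_sum shifted_form v F); last first.
  apply: eq_shuffle_sum => s t _; rewrite cross_shifted_form scalerA -signzD.
  by rewrite /F.
rewrite -[in LHS](scale1r (shuffle_sum _ _ _)) -scalerDl; congr (_ *: _).
apply: eq_shuffle_sum => s t st; have [hs ht] : hargs s /\ hargs t.
  by apply/hargs_cat; apply: hargs_perm hv.
rewrite /F PV_OV_bullet
  (contract_contracts _ ht (ghomog_derived_bracket hA hs)) linearZ /= scalerA
  -signzD.
rewrite -[RHS]scale1r -[1 in RHS](expr0z (-1)); congr (_ *: _); sign_eq.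
Qed.

End IteratedAction.

(** * The brackets as derived brackets *)

Section TupleSums.
Variables (T : finType) (V : nmodType).

Lemma big_tuple_cons n (F : seq T -> V) :
  \sum_(a : n.+1.-tuple T) F a = \sum_(x : T) \sum_(a : n.-tuple T) F (x :: a).
Proof.
rewrite pair_big /= (reindex (fun p : T * n.-tuple T => [tuple of p.1 :: p.2]))
  //=.
exists (fun a : n.+1.-tuple T => (thead a, [tuple of behead a])) => [[x a]|a]
  _ /=.
  by congr (_, _); apply: val_inj.
by rewrite -tuple_eta.
Qed.

Lemma big_tuple_rcons n (F : seq T -> V) :
  \sum_(a : n.+1.-tuple T) F a =
    \sum_(x : T) \sum_(a : n.-tuple T) F (rcons a x).
Proof.
elim: n F => [|n IHn] F; rewrite big_tuple_cons.
  by apply: eq_bigr => x _; apply: eq_bigr => a _; rewrite (tuple0 a).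
under eq_bigr => x _ do rewrite (IHn (fun a => F (x :: a))).
rewrite exchange_big; apply: eq_bigr => y _ /=.
by rewrite (big_tuple_cons _ (fun a => F (rcons a y))).
Qed.

Lemma big_tuple0 (F : seq T -> V) : \sum_(a : 0.-tuple T) F a = F [::].
Proof.
rewrite (bigD1 [tuple]) //= big1 ?addr0 // => a /eqP[]; exact: tuple0.
Qed.

End TupleSums.

(** Passes from symmetry under all permutations, as in [pv_coefficients], to the adjacent exchanges
    of [swap_sign]. *)
Lemma adjacent_permutation (T : eqType) (b : T -> T -> int) (u : seq T) x y t n
    (v : n.-tuple T) : v = u ++ y :: x :: t :> seq T ->
  exists s : 'S_n, permute v s = u ++ x :: y :: t :> seq T /\
    inv_exp (fun i j => b (tnth v i) (tnth v j)) s = b x y.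
Proof.
have perm1E k (w : k.-tuple T) : permute w 1%g = w.
  by apply: eq_from_tnth => i; rewrite tnth_mktuple perm1.
elim: u n v => [|z u IHu] n v /=.
  move=> ev; have en : n = (size t).+2 by rewrite -(size_tuple v) ev.
  rewrite en in v ev *.
  have {ev} -> : v = [tuple of y :: x :: in_tuple t] by apply: val_inj.
  (* The exchange of the first two letters: the head goes to position 1 and the tail keeps its
     order. *)
  exists (lift_perm (Ordinal (isT : 1 < (size t).+2)%N) ord0 1); split.
    by rewrite permute_insert perm1E /= take0 drop0.
  rewrite inv_exp_lift (bigD1 ord0) //= big1 => [|k]; last first.
    by case/andP => lt_k /eqP ne; case: ne; apply: val_inj; move: lt_k => /=;
      case: (nat_of_ord k).
  rewrite perm1 [X in _ + X]big1 ?addr0 // => k _; rewrite big1 // => l.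
  by rewrite !perm1 => /andP[/ltn_trans h /h]; rewrite ltnn.
move=> ev; have en : n =
  (size (u ++ y :: x :: t)).+1 by rewrite -(size_tuple v) ev.
rewrite en in v ev *.
have {ev} -> : v = [tuple of z :: in_tuple (u ++ y :: x :: t)]
  by apply: val_inj.
have [s [es hs]] := IHu _ (in_tuple (u ++ y :: x :: t)) erefl.
exists (lift_perm ord0 ord0 s); split.
  by rewrite permute_insert take0 drop0 es.
rewrite inv_exp_lift big1 // add0r -[RHS]hs.
by apply: eq_bigr => i _; apply: eq_bigr => j _; rewrite !tnthS.
Qed.

Section Link.
Variables (K : fieldType) (m : nat) (dV : 'I_m -> int).
Local Notation td := (tdeg dV).
Local Notation pd := (pvdeg dV).
Local Notation O := (gseries K td).
Local Notation P := (gseries K pd).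
Local Notation arg := (int * O)%type.
Local Notation hargs := (homog_args (@ghomog K m td)).
Implicit Types (f g : O) (A B : P) (v : seq arg) (a : seq 'I_m)
  (c : seq 'I_m -> O).
Local Notation dpsi a := (gderr (psivar a)).
Local Notation psi a := (gvar K (psivar a) : P).

Definition psi_form (x y : 'I_m) : int := (1 - td x) * (1 - td y).

Definition coef_sym c := swap_sign psi_form (fun=> True) c.

Lemma all_inT (T : eqType) (s : seq T) : all_in (fun=> True) s.
Proof. by []. Qed.

Lemma coef_sym_rcons c x : coef_sym c -> coef_sym (fun a => c (rcons a x)).
Proof. by move=> h u y z t _; rewrite !rcons_cat !rcons_cons; apply: h. Qed.

Lemma coefficients_coef_sym A c : pv_coefficients A c -> coef_sym c.
Proof.
move=> cP u x y t _; pose v := in_tuple (u ++ y :: x :: t).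
have [s [es hs]] := adjacent_permutation psi_form (erefl (tval v)).
have [|+ _] := cP (size (u ++ y :: x :: t)); first by rewrite size_cat /= addnS.
by move=> /(_ v s); rewrite es => ->; rewrite -hs.
Qed.

Definition psi_sum n c : P :=
  \sum_(a : n.-tuple 'I_m) OV_PV (c a) * \prod_(x <- tval a) psi x.

Lemma psi_sumS n c :
  psi_sum n.+1 c = \sum_(x < m) psi_sum n (fun a => c (rcons a x)) * psi x.
Proof.
rewrite /psi_sum (big_tuple_rcons
  _ (fun a => OV_PV (c a) * \prod_(x <- a) psi x)).
apply: eq_bigr => x _; rewrite mulr_suml; apply: eq_bigr => a _.
by rewrite -cats1 big_cat big_seq1 mulrA.
Qed.

Lemma psi_sumZ n k c : psi_sum n (fun a => k *: c a) = k *: psi_sum n c.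
Proof.
by rewrite /psi_sum scaler_sumr; apply: eq_bigr => a _;
  rewrite linearZ /= scalerAl.
Qed.

(* Euler: by the symmetry of [c], each of the [n] factors [psi] contributes
   equally. *)
Lemma dpsi_psi_sum n x c : coef_sym c ->
  dpsi x (psi_sum n c) = n%:R *: psi_sum n.-1 (fun a => c (rcons a x)).
Proof.
elim: n c => [|n IHn] c csym.
  by rewrite /psi_sum (big_tuple0
    (fun a => OV_PV (c a) * \prod_(x <- a) psi x)) big_nil mulr1 gderr_OV_PV
    scale0r.
rewrite psi_sumS linear_sum /=.
have psi_homog y : ghomog (1 - td y) (psi y) by rewrite -(pvdeg_psivar dV);
  exact: ghomog_gvar.
under eq_bigr => y _.
  rewrite (dpsiM _ _ (psi_homog y)) (IHn _ (coef_sym_rcons y csym)) gderr_var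
    eq_rshift.
  over.
rewrite big_split /= (bigD1 x) //= eqxx mulr1 big1 ?addr0; last first.
  by move=> y /negbTE xy; rewrite eq_sym xy mulr0.
rewrite -natr1 scalerDl scale1r addrC; congr (_ + _).
case: n IHn => [|n] IHn.
  by rewrite big1 ?scale0r // => y _; rewrite scale0r mul0r scaler0.
rewrite [in RHS]psi_sumS scaler_sumr; apply: eq_bigr => y _ /=.
rewrite -scalerAl scalerA mulrC -scalerA scalerAl -psi_sumZ.
congr (_ *: (psi_sum n _ * _)); apply/funext => a.
have := csym a y x [::] (@all_inT _ _).
by rewrite -!cat_rcons !cats0 => ->; rewrite /psi_form mulrC.
Qed.

Fixpoint dpsis a A : P := if a is x :: a' then dpsis a' (dpsi x A) else A.

Lemma dpsis_is_linear a : linear (dpsis a).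
Proof. by elim: a => [|x a IHa] // k A B /=; rewrite linearP IHa. Qed.
HB.instance Definition _ a :=
  GRing.isLinear.Build K P P _ (dpsis a) (dpsis_is_linear a).

Lemma wcomp_dpsis a A : pv_wcomp 0 (dpsis a A) = dpsis a (pv_wcomp (size a) A).
Proof. by elim: a A => [|x a IHa] A //=; rewrite IHa pv_wcomp_derr. Qed.

(** Each derivative from the right strips the last index, so the indices come out reversed; the
    successive integer factors form the factorial that cancels the one in [pv_coefficients]. *)
Lemma dpsis_psi_sum a c : coef_sym c ->
  dpsis a (psi_sum (size a) c) = (size a)`!%:R *: OV_PV (c (rev a)).
Proof.
elim: a c => [|x a IHa] c csym /=.
  by rewrite /psi_sum (big_tuple0
    (fun a => OV_PV (c a) * \prod_(x <- a) psi x)) big_nil mulr1 scale1r.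
rewrite dpsi_psi_sum // linearZ /= IHa; last exact: coef_sym_rcons.
by rewrite scalerA -natrM -factS rev_cons.
Qed.

(** The Koszul exponent of reversing a product of the psi. *)
Fixpoint rev_sign a : int :=
  if a is x :: a' then (1 - td x) * (\sum_(y <- a') (1 - td y))
    + rev_sign a' else 0.

Lemma coef_sym_rev a c : coef_sym c -> c (rev a) = (-1) ^ rev_sign a *: c a.
Proof.
elim: a c => [|x a IHa] c csym /=; first by rewrite scale1r.
rewrite rev_cons -cats1 (swap_sign_front csym (@all_inT _ _)) cats0.
rewrite (IHa (fun a => c (x :: a))); last by move=> u y z t _;
  apply: (csym (x :: u)).
rewrite scalerA -signzD; congr ((-1) ^ (_ + _) *: _).
rewrite (perm_big a) /=; last by rewrite perm_rev.
by rewrite mulr_sumr; apply: eq_bigr => y _; rewrite /psi_form mulrC.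
Qed.

Lemma PV_OV_dpsis (charK : [pchar K] =i pred0) A c a : pv_coefficients A c ->
  a != [::] ->
  PV_OV (dpsis a A) = (-1) ^ rev_sign a *: c a.
Proof.
move=> cP a0; have csym := coefficients_coef_sym cP.
rewrite -(coef_sym_rev _ csym); apply: OV_PV_inj; rewrite PV_OVK wcomp_dpsis.
have [|_ ->] := cP (size a); first by rewrite lt0n size_eq0.
rewrite (_ : \sum_(b : _) _ = psi_sum (size a) c); last first.
  by apply: eq_bigr => b _; rewrite /gprod big_map.
rewrite linearZ /= dpsis_psi_sum // scalerA mulVf ?scale1r //.
by rewrite ((pcharf0P K).1 charK) gtn_eqF ?fact_gt0.
Qed.

Fixpoint der_prod a v : O :=
  match a, v with x :: a', f :: v' => gderl x f.2
    * der_prod a' v' | _, _ => 1 end.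

Definition adeg a : int := \sum_(x <- a) td x.

Lemma ghomog_der_prod a v : size a = size v -> hargs v ->
  ghomog (totdeg v - adeg a) (der_prod a v).
Proof.
rewrite /totdeg /adeg; elim: v a => [|f v IHv] [|x a] //=.
  by rewrite !big_nil => _ _; rewrite subr0; exact: ghomog1.
move=> [sz] /hargs_cons [hf hv]; rewrite !big_cons.
rewrite (_ : _ - _ = f.1 - td x + (\sum_(x <- v) x.1 - \sum_(x <- a) td x));
  last by ring.
by apply: ghomogM; [exact: ghomog_derl | exact: IHv].
Qed.

(** The net exponent of expanding successive contractions: the derivative of each argument crosses
    the psi of all later indices. *)
Fixpoint act_sign a v : int :=
  match a, v with
  | x :: a', f :: v' => (f.1 - td x) * (\sum_(y <- a') (1 - td y))
    + act_sign a' v'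
  | _, _ => 0
  end.

Lemma sum_psideg a : \sum_(y <- a) (1 - td y) = (size a)%:Z - adeg a.
Proof.
rewrite /adeg; elim: a => [|x a IHa]; first by rewrite !big_nil.
by rewrite !big_cons IHa /= -[in RHS]addn1 PoszD; ring.
Qed.

Lemma derived_bracket_expand A v : hargs v ->
  derived_bracket A v = \sum_(a : (size v).-tuple 'I_m)
    (-1) ^ act_sign a v *: (PV_OV (dpsis a A) * der_prod a v).
Proof.
elim: v A => [|f v IHv] A.
  rewrite (big_tuple0 (fun a => (-1) ^ act_sign a [::]
    *: (PV_OV (dpsis a A) * der_prod a [::]))) /=.
  by rewrite scale1r mulr1.
move=> /hargs_cons [hf hv];
  rewrite /derived_bracket /= contractE linear_sum linear_sum /=.
rewrite (big_tuple_cons _ (fun a => (-1) ^ act_sign a (f :: v) *: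
  (PV_OV (dpsis a A) * der_prod a (f :: v)))) /=.
apply: eq_bigr => x _.
rewrite (contracts_mulr _ hv (@ghomog_derl _ _ _ _ x _ hf)) linearZ /= PV_OVM
  OV_PVK.
rewrite -/(derived_bracket _ v) IHv // mulr_suml scaler_sumr;
  apply: eq_bigr => a _.
rewrite -scalerAl scalerA -mulrA.
have sza : size a = size v by rewrite size_tuple.
rewrite (gmulC (ghomog_der_prod sza hv) (@ghomog_derl _ _ _ _ x _ hf))
  -scalerAr scalerA -!signzD.
by rewrite sum_psideg sza shifted_degE; congr (_ *: _); sign_eq.
Qed.

(** The exponent in [bracket], regrouped by arguments: |f_j|, and the unit by which f_j is counted,
    meet the degree of every later t^a. *)
Fixpoint bracket_sign a v : int :=
  match a, v with
  | x :: a', f :: v' => (f.1 + 1) * adeg a' + bracket_sign a' v'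
  | _, _ => 0
  end.

Lemma bracket_signE n (a : n.-tuple 'I_m) (v : n.-tuple arg) :
  \sum_(i < n) td (tnth a i) * (\sum_(j < n | (j < i)%N) (tnth v j).1 + i%:Z) =
  bracket_sign a v.
Proof.
elim: n a v => [|n IHn] a v; first by rewrite big_ord0 (tuple0 a).
case/tupleP: a => x a; case/tupleP: v => f v;
  rewrite big_ord_recl /= big1 // addr0 mulr0 add0r.
rewrite /adeg -IHn big_tuple mulr_sumr -big_split; apply: eq_bigr => i _ /=.
have -> : \sum_(j < n.+1 | (j < bump 0 i)%N) (tnth [tuple of f :: v] j).1 =
    f.1 + \sum_(j < n | (j < i)%N) (tnth v j).1.
  rewrite big_mkcond big_ord_recl tnth0 [in RHS]big_mkcond; congr (_ + _).
  by apply: eq_bigr => j _; rewrite tnthS.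
by rewrite tnthS /bump /= add1n -[i.+1]addn1 PoszD; ring.
Qed.

Lemma der_prodE n (a : n.-tuple 'I_m) (v : n.-tuple arg) :
  gprod [seq gderl (tnth a i) (tnth v i).2 | i <- enum 'I_n] = der_prod a v.
Proof.
elim: n a v => [|n IHn] a v.
  by rewrite (tuple0 a) (size0nil (size_enum_ord 0)) /gprod big_nil.
case/tupleP: a => x a; case/tupleP: v => f v;
  rewrite enum_ordSl /= /gprod big_cons !tnth0.
congr (_ * _); rewrite -IHn -map_comp; congr gprod.
by apply: eq_map => i /=; rewrite !tnthS.
Qed.

Lemma bracket_expand c v : bracket c v =
  \sum_(a : (size v).-tuple 'I_m) (-1) ^ bracket_sign a v
    *: (c a * der_prod a v).
Proof.
rewrite /bracket; apply: eq_bigr => a _.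
by rewrite bracket_signE der_prodE.
Qed.

Fixpoint decalage_exp v : int :=
  if v is x :: v' then (size v')%:Z * (x.1 - 1) + decalage_exp v' else 0.

(** Modulo 2 the degree of t^x drops out of the head terms, leaving |f| + 1 times the total degree
    of the later psi. Their number gives the decalage and the degrees of their t the sign of the
    bracket, so the discrepancy does not depend on the indices. *)
Lemma decalage_sign a v : size a = size v ->
  (-1) ^ (act_sign a v + rev_sign a) =
    (-1) ^ (decalage_exp v + bracket_sign a v) :> K.
Proof.
elim: v a => [|f v IHv] [|x a] //= [sz]; have := IHv _ sz.
rewrite !sum_psideg sz !signzD => e.
rewrite [LHS](AC (2*2) ((1*3)*(2*4))) /= e [RHS](AC (2*2) ((1*3)*(2*4))) /=.
by congr (_ * _); rewrite -!signzD; sign_eq.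
Qed.

Lemma bracketE (charK : [pchar K] =i pred0) A c v : pv_coefficients A c ->
  v != [::] -> hargs v -> bracket c v =
    (-1) ^ decalage_exp v *: derived_bracket A v.
Proof.
move=> cP v0 hv; rewrite bracket_expand derived_bracket_expand // scaler_sumr.
apply: eq_bigr => a _; have sza : size a = size v by rewrite size_tuple.
rewrite (PV_OV_dpsis charK cP) -?size_eq0 ?sza ?size_eq0 //.
rewrite -scalerAl !scalerA -mulrA -signzD decalage_sign // -signzD.
by congr (_ *: _); sign_eq.
Qed.

End Link.

(** * The Jacobi identities *)

Definition skew_form (T : Type) (x y : int * T) : int := x.1 * y.1 + 1.

(** [skew_form] merges the Koszul sign with the signature. The Jacobiator has no empty inner block,
    and r = n + 1 - s is the length of t plus one. *)
Lemma jacobiator_shuffle_sum (K : fieldType) (W : lmodType K)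
  (l : seq (int * W) -> W)
    n (v : n.-tuple (int * W)) :
  jacobiator (fun r _ => r) l v = shuffle_sum (@skew_form W) v (fun s t =>
    if nilp s then 0 else (-1) ^+ (size t).+1 *: l
      ((totdeg s + 2 - (size s)%:Z, l s) :: t)).
Proof.
rewrite -shuffle_sum_unshuffle /jacobiator big_mkcond; apply: eq_bigr => s _.
have le_sn : (s <= n)%N by rewrite -ltnS.
have szt (p : 'S_n) : size (take s (permute v p)) =
  s by rewrite size_takel ?size_tuple.
case: posnP => [s0|s_gt0].
  by rewrite big1 // => p _; rewrite /nilp szt s0 scaler0.
apply: eq_bigr => p _ /=; rewrite /nilp szt (gtn_eqF s_gt0) scalerA koszul_sign.
by rewrite size_drop size_tuple card_ord subSn.
Qed.

Section Main.
Variables (K : fieldType) (charK : [pchar K] =i pred0) (m : nat)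
  (dV : 'I_m -> int).
Local Notation td := (tdeg dV).
Local Notation pd := (pvdeg dV).
Local Notation O := (gseries K td).
Local Notation P := (gseries K pd).
Local Notation arg := (int * O)%type.
Local Notation hom := (@ghomog K m td).
Local Notation hargs := (homog_args hom).
Local Notation dpsi a := (gderr (psivar a)).
Variables (A : P) (c : seq 'I_m -> O) (cP : pv_coefficients A c).
Implicit Types (v s t : seq arg) (f g h : O).

Lemma decalage_exp_cat s t : decalage_exp (s ++ t) =
  decalage_exp s + (size t)%:Z * shifted_deg s + decalage_exp t.
Proof.
elim: s => [|x s IHs] /=; first by rewrite /shifted_deg big_nil mulr0 !add0r.
by rewrite IHs shifted_deg_cons size_cat PoszD; ring.
Qed.

Lemma sum_skew_form s (x : arg) :
  \sum_(y <- s) skew_form y x =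
    (shifted_deg s + (size s)%:Z) * x.1 + (size s)%:Z.
Proof.
elim: s => [|y s IHs]; first by rewrite /shifted_deg !big_nil add0r mul0r.
by rewrite big_cons IHs shifted_deg_cons /skew_form /= -[in RHS]addn1 PoszD;
  ring.
Qed.

(** The forms (x - 1)(y - 1) and x y + 1 differ modulo 2 by x + y, which is the change of
    [decalage_exp] when neighbours of degrees x and y are exchanged. *)
Lemma shuffle_sum_decalage (V : lmodType K) v (G : seq arg -> seq arg -> V) :
  shuffle_sum (@shifted_form K m dV) v
    (fun s t => (-1) ^ decalage_exp (s ++ t) *: G s t) =
  (-1) ^ decalage_exp v *: shuffle_sum (@skew_form O) v G.
Proof.
elim: v G => [|x v IHv] G /=; first by rewrite scale1r.
rewrite [(size v)%:Z * _ + _]addrC signzD -scalerA scalerDr -!shuffle_sumZ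
  scalerDr -!IHv.
congr (_ + _); apply: eq_shuffle_sum => s t /perm_size sz.
  by rewrite scalerA -signzD /= sz addrC.
rewrite sum_shifted_form sum_skew_form !scalerA -!signzD !decalage_exp_cat /=;
  congr (_ *: _).
by move: sz; rewrite size_cat => <-; rewrite PoszD -addn1 PoszD; sign_eq.
Qed.

Lemma derived_bracket_cat B s t : derived_bracket B (s ++ t) =
  PV_OV (contracts t (contracts s B)).
Proof. by rewrite /derived_bracket contracts_cat. Qed.

Lemma derived_bracket_linear B s k a f g t :
  derived_bracket B (s ++ (k, a *: f + g) :: t) =
    a *: derived_bracket B (s ++ (k, f) :: t)
      + derived_bracket B (s ++ (k, g) :: t).
Proof. by rewrite !derived_bracket_cat /= contractP !linearP. Qed.

Lemma derived_bracket0 B k t : derived_bracket B ((k, 0 : O) :: t) = 0.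
Proof. by rewrite /derived_bracket /= /contract !linear0. Qed.

Lemma derived_bracketZ B a k f t : derived_bracket B ((k, a *: f) :: t) =
  a *: derived_bracket B ((k, f) :: t).
Proof.
have := derived_bracket_linear B [::] k a f 0 t; rewrite /= addr0 => ->.
by rewrite derived_bracket0 addr0.
Qed.

Lemma swap_derived_bracket B : swap_sign (@shifted_form K m dV)
  (fun x => hom x.1 x.2) (derived_bracket B).
Proof.
move=> u x y t /hargs_cat [_ /hargs_cons [hx /hargs_cons [hy _]]].
by rewrite !derived_bracket_cat /= (contractC _ hx hy) !linearZ.
Qed.

Lemma swap_bracket : swap_sign (@skew_form O) (fun x => hom x.1 x.2)
  (bracket c).
Proof.
move=> u x y t D; have D' : hargs (u ++ y :: x :: t).
  apply: hargs_perm D;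
    by rewrite perm_cat2l -[y :: x :: t]/([:: y] ++ [:: x] ++ t) perm_catCA.
have n0 (z : arg) w : u ++ z :: w != [::] by rewrite -size_eq0 size_cat addnS.
rewrite (bracketE charK cP (n0 _ _) D) (bracketE charK cP (n0 _ _) D').
rewrite (swap_derived_bracket _ D) !scalerA -!signzD !decalage_exp_cat /=
  /shifted_form /skew_form; congr (_ *: _).
by sign_eq.
Qed.

Lemma bracket_skew : graded_skew hom (bracket c).
Proof.
move=> n v s _ hv; rewrite (swap_sign_permute _ swap_bracket hv) koszul_sign.
by [].
Qed.

Lemma contract_prod k p q f g B : ghomog k B -> ghomog p f -> ghomog q g ->
  contract (f * g) B =
    contract f B * OV_PV g + (-1) ^ (p * (k - 1)) *: (OV_PV f * contract g B).
Proof.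
move=> hB hf hg; rewrite !contractE mulr_suml mulr_sumr scaler_sumr -big_split.
apply: eq_bigr => a _ /=;
  rewrite (gderlM _ _ hf) linearD linearZ /= !OV_PVM mulrDr mulrA.
congr (_ + _); rewrite -scalerAr !mulrA.
rewrite (gmulC (@ghomog_psi _ _ _ _ a _ hB) ((ghomog_OV_PV _ _).2 hf))
  -scalerAl scalerA.
by rewrite -signzD; congr (_ *: _); sign_eq.
Qed.

(** Contraction with f has degree |f| - 1, so the component of degree e of L_n comes from the
    component of degree e + n of A. This reduces an inhomogeneous field to homogeneous ones. *)
Lemma bracket_compE e v : v != [::] -> hargs v ->
  bracket_comp c e v =
    (-1) ^ decalage_exp v *: derived_bracket (ghcomp (e + (size v)%:Z) A) v.
Proof.
move=> v0 hv; rewrite /bracket_comp (bracketE charK cP v0 hv) linearZ /=;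
  congr (_ *: _).
rewrite /derived_bracket ghcomp_PV_OV -ghcomp_contracts // shifted_degE;
  congr (PV_OV (ghcomp _ _)).
by ring.
Qed.

(** After contraction with fs, the product rule is applied at gh. Being free of psi, g and h factor
    out of the contractions with fs', where only h, standing on the right, picks up a sign. *)
Lemma bracket_leibniz : graded_leibniz c.
Proof.
move=> e p q fs fs' g h hfs hfs' hg hh.
have n0 (z : arg) : fs ++ z :: fs' != [::] by rewrite -size_eq0 size_cat addnS.
have hargs_mid k f : ghomog k f -> hargs (fs ++ (k, f) :: fs').
  by move=> hf; apply/hargs_cat; split=> //; apply/hargs_cons.
rewrite !bracket_compE ?n0 //; try exact: hargs_mid;
  last by apply/hargs_mid/ghomogM.
rewrite !size_cat /=; set k : int := e + _; set B := ghcomp k A.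
have hX : ghomog (k + shifted_deg fs) (contracts fs B)
  by apply: ghomog_contracts => //; exact: ghomog_ghcomp.
rewrite !derived_bracket_cat /= (contract_prod hX hg hh) linearD linearZ /=.
rewrite (contracts_mulr _ hfs' hh)
  (contracts_mull _ hfs' (ghomog_contract hh hX)).
rewrite linearD !linearZ /= !PV_OVM !OV_PVK scalerDr !scalerA addrC.
rewrite -gmulZr -gmulZl !scalerA -!signzD.
rewrite !decalage_exp_cat /= /k !shifted_degE.
by congr (_ *: _ + _ *: _); sign_eq.
Qed.

Lemma graded_space_series : graded_space hom.
Proof.
split=> [k|k a u w hu hw|s w us hw sum0 k ks]; first exact: ghomog0.
  by apply: ghomogD => //; exact: ghomogZ.
have := congr1 (ghcomp k) sum0;
  rewrite linear_sum linear0 (bigD1_seq k) //= ghcomp_id //.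
rewrite big1 ?addr0 // => l lk.
by rewrite (ghcomp_homog _ (hw l)) eq_sym (negbTE lk).
Qed.

Lemma bracket_multilinear : multilinear hom (bracket c).
Proof.
move=> v v' k a u w hv hv' hu hw.
have n0 (z : arg) : v ++ z :: v' != [::] by rewrite -size_eq0 size_cat addnS.
have hargs_mid f : ghomog k f -> hargs (v ++ (k, f) :: v').
  by move=> hf; apply/hargs_cat; split=> //; apply/hargs_cons.
rewrite !(bracketE charK cP) ?n0 //; try exact: hargs_mid; last first.
  by apply: hargs_mid; apply: ghomogD => //; exact: ghomogZ.
by rewrite derived_bracket_linear !decalage_exp_cat /= scalerDr !scalerA mulrC.
Qed.

Lemma bracket_degree v : ghomog 2 A -> v != [::] -> hargs v ->
  hom (totdeg v + 2 - (size v)%:Z) (bracket c v).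
Proof.
move=> hA v0 hv; rewrite (bracketE charK cP v0 hv); apply: ghomogZ.
rewrite (_ : _ - _ = 2 + shifted_deg v); first exact: ghomog_derived_bracket.
by rewrite shifted_degE; ring.
Qed.

(** The nullary bracket is the part of weight zero. Its vanishing removes the terms with an empty
    inner block, which the Jacobiator does not contain. *)
Lemma derived_bracket_nil : pv_positive A -> derived_bracket A [::] = 0.
Proof. by move=> A0; apply: OV_PV_inj; rewrite PV_OVK linear0. Qed.

(** The inner bracket has degree 2 + [shifted_deg s], so the decalage exponents of the inner and
    outer brackets add up, modulo 2, to that of s ++ t plus the length of t. That length cancels
    against (-1)^r except for one minus sign, the one in the constant -2. *)
Lemma derived_bracket_jacobiator n (v : n.-tuple arg) : pv_positive A ->
  ghomog 2 A ->
  hargs v ->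
  derived_bracket (schouten 2 2 A A) v =
    (- 2%:R * (-1) ^ decalage_exp v) *: jacobiator (fun r _ => r) (bracket c) v.
Proof.
move=> A0 hA hv; rewrite derived_bracket_schouten // jacobiator_shuffle_sum
  mulNr -mulrN -scalerA; congr (_ *: _).
rewrite scaleNr -shuffle_sum_decalage -scaleN1r -shuffle_sumZ;
  apply: eq_shuffle_sum => s t st.
have [hs ht] : hargs s /\ hargs t by apply/hargs_cat; exact: hargs_perm hv.
case: nilP => [->|/eqP s0];
  first by rewrite derived_bracket_nil // derived_bracket0 !scaler0.
have hd := bracket_degree hA s0 hs.
have hdt : hargs ((totdeg s + 2 - (size s)%:Z, bracket c s) :: t)
  by apply/hargs_cons.
rewrite (bracketE charK cP _ hdt) //.
rewrite (bracketE charK cP s0 hs) derived_bracketZ /= decalage_exp_cat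
  (_ : _ + 2 - _ = 2 + shifted_deg s).
  rewrite -[X in _ = X *: _]expr1z [_ ^+ _.+1]exprnP !scalerA -!signzD.
  by rewrite -[LHS]scale1r -[1 in LHS](expr0z (-1)); congr (_ *: _); sign_eq.
by rewrite shifted_degE; ring.
Qed.

(** * Reconstruction from coordinate functions, and the equivalence *)

Definition coords (a : seq 'I_m) : seq arg :=
  [seq (td x, gvar K x : O) | x <- a].

Lemma hargs_coords a : hargs (coords a).
Proof. by move=> x /mapP[y _ ->]; exact: ghomog_gvar. Qed.

Lemma contracts_coords a B : contracts (coords a) B = dpsis a B.
Proof.
elim: a B => [|x a IHa] B //=;
  rewrite IHa contractE (bigD1 x) //= gderl_var eqxx OV_PV1 mulr1.
rewrite big1 ?addr0 // => y /negbTE yx; by rewrite gderl_var yx linear0 mulr0.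
Qed.

(** Induction on the psi-weight of an exponent with nonzero coefficient. Weight zero is tested by
    the empty list; otherwise the derivative in some psi_x that occurs lowers the weight, and in
    characteristic zero its integer factor keeps the coefficient nonzero. *)
Lemma ghomog_coords k B :
  (forall a, ghomog (k + shifted_deg (coords a))
    (derived_bracket B (coords a))) -> ghomog k B.
Proof.
move=> hB; apply/ghomogP => N; have [w] := ubnP (eweight N).
elim: w k B N hB => // w IHw k B N hB; rewrite ltnS => le_w BN.
have [w0|w_gt0] := posnP (eweight N).
  have := hB [::]; rewrite /shifted_deg big_nil addr0 => /ghomogP h0.
  by rewrite -(h0 (eres N)) ?gcoef_PV_OV ?eresK // -(edeg_ext dV) eresK.
have [x Nx] : exists x, (0 < N (psivar x))%N.
  apply/existsP; apply: contraLR w_gt0; rewrite negb_exists => /forallP h.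
  by rewrite lt0n negbK /eweight sum_nat_eq0; apply/forallP => x;
    rewrite eqn0Ngt h.
pose N' := esub N (edelta (psivar x)).
have eN : eadd N' (edelta (psivar x)) = N.
  rewrite eaddC esubK //; apply/eleP => j; rewrite ffunE.
  by case: eqP => // ->.
have e : expdeg pd N' = k - (1 - td x).
  apply: (IHw _ (dpsi x B)).
  - move=> a; have := hB (x :: a);
    rewrite /derived_bracket !contracts_coords /= shifted_deg_cons /=.
    by rewrite (_ : k + _ = k - (1 - td x) + shifted_deg (coords a)) //; ring.
  - have := eweightD N' (edelta (psivar x)); rewrite eN eweight_psivar => wN.
    by move: le_w; rewrite wN addn1.
  rewrite gcoef_derr eN !mulf_neq0 ?expfz_neq0 ?oppr_eq0 ?oner_eq0 //.
  by rewrite ((pcharf0P K).1 charK).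
by rewrite -eN edegD e edeg_delta pvdeg_psivar subrK.
Qed.

Lemma degree_ghomog : pv_positive A ->
  (forall v, (0 < size v)%N -> hargs v ->
     hom (totdeg v + 2 - (size v)%:Z) (bracket c v)) -> ghomog 2 A.
Proof.
move=> A0 hdeg; apply: ghomog_coords => a.
have [->|a0] := eqVneq a [::]; first by rewrite derived_bracket_nil //;
  exact: ghomog0.
have sz : (0 < size (coords a))%N by rewrite size_map lt0n size_eq0.
have := hdeg _ sz (@hargs_coords a);
  rewrite (bracketE charK cP) -?size_eq0 -?lt0n //; last first.
  exact: hargs_coords.
move=> /(@ghomogZ _ _ _ _ ((-1) ^ decalage_exp (coords a)) _);
  rewrite scalerA -signzD.
rewrite (_ : (-1) ^ _ = 1) ?scale1r; last by rewrite -[RHS](expr0z (-1));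
  sign_eq.
by rewrite (_ : _ - _ = 2 + shifted_deg (coords a)) // shifted_degE; ring.
Qed.

Lemma bracket_linfty : pv_positive A -> linfty hom (bracket c) <->
  extended_poisson A.
Proof.
have n2 : 2%:R != 0 :> K by rewrite ((pcharf0P K).1 charK).
have nz e : (-1) ^ e != 0 :> K by rewrite expfz_neq0 ?oppr_eq0 ?oner_eq0.
move=> A0; split=> [[_ _ hdeg _ jac]|[_ hA S0]].
  have hA := degree_ghomog A0 hdeg; split=> //.
  have S0 a : derived_bracket (schouten 2 2 A A) (coords a) = 0.
    (* The Jacobi identities start at n = 1; for the empty list the vanishing comes from positivity
       of [A]. *)
    have [->|a0] := eqVneq a [::].
      by rewrite derived_bracket_schouten //= derived_bracket_nil //
        derived_bracket0 scaler0.
    rewrite (derived_bracket_jacobiator (v := in_tuple (coords a))) ?jac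
      ?scaler0 //; try exact: hargs_coords.
    by rewrite size_map lt0n size_eq0.
  (* With all coordinate contractions zero at psi = 0, the bracket is homogeneous of every degree;
     the degrees 0 and 1 already force it to vanish. *)
  by apply: (@ghomog_eq0 _ _ _ 0 1) => //; apply: ghomog_coords => a;
    rewrite S0; exact: ghomog0.
split.
- exact: graded_space_series.
- exact: bracket_multilinear.
- by move=> v v0; apply: bracket_degree; rewrite // -size_eq0 -lt0n.
- exact: bracket_skew.
move=> n v n_gt0 hv; have := derived_bracket_jacobiator A0 hA hv.
rewrite S0 /derived_bracket !linear0 => /esym/eqP;
  rewrite scaler_eq0 mulf_eq0 oppr_eq0.
by rewrite (negbTE n2) (negbTE (nz _)) => /eqP.
Qed.

End Main.

Theorem theorem3p8p1 (K : fieldType) (charK : [pchar K] =i pred0)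
    (m : nat) (dV : 'I_m -> int) (Gamma : PV K dV)
    (c : seq 'I_m -> OV K dV)
    (Gamma_pos : pv_positive Gamma) (cP : pv_coefficients Gamma c) :
  [/\ graded_skew (@ghomog K m (tdeg dV)) (bracket c),
      graded_leibniz c
    & linfty (@ghomog K m (tdeg dV)) (bracket c) <-> extended_poisson Gamma].
Proof.
split.
- exact: bracket_skew cP.
- exact: bracket_leibniz cP.
- exact: bracket_linfty.
Qed.
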